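(* Let $L$ be a countably categorical linear order. Then the automorphism group $\mathrm{Aut}(L)$, with the topology of pointwise convergence, is extremely amenable.
   Context: A countably categorical linear order is a countable (possibly finite) linear order $L$ such that every countable linear order satisfying the same first-order theory as $L$ (in the language of linear orders) is isomorphic to $L$. A topological group $G$ is extremely amenable if every continuous action of $G$ on a compact Hausdorff space has a fixed point. *)

(* Defs.v *)
From HB Require Import structures.
From mathcomp Require Import all_boot all_order.
From mathcomp Require Import boolp classical_sets functions cardinality.
From mathcomp Require Import topology function_spaces.

Set Implicit Arguments.
Unset Strict Implicit.
Unset Printing Implicit Defensive.

Import Order.TTheory.

Local Open Scope classical_set_scope.

(* [formula n] is the type of formulas, in the language of orders with
   equality, whose free variables are among the n variables 'I_n. Under a
   quantifier the bound variable is [ord0] and the variable i of the context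
   becomes [lift ord0 i]. Keeping the free variables in the type lets sentences
   ([formula 0]) be evaluated in the empty order as well. *)
Inductive formula : nat -> Type :=
| FEq n (i j : 'I_n) : formula n
| FLe n (i j : 'I_n) : formula n
| FFalse n : formula n
| FImp n (p q : formula n) : formula n
| FAll n (p : formula n.+1) : formula n.

Definition env_cons (T : Type) n (x : T) (v : 'I_n -> T) (i : 'I_n.+1) : T :=
  if unlift ord0 i is Some j then v j else x.

Definition env_nil (T : Type) (i : 'I_0) : T :=
  False_rect T (notF (valP i)).

Fixpoint sat d (L : orderType d) n (p : formula n) : ('I_n -> L) -> Prop :=
  match p in formula n return ('I_n -> L) -> Prop with
  | FEq _ i j => fun v => v i = v j
  | FLe _ i j => fun v => (v i <= v j)%O
  | FFalse _ => fun=> False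
  | FImp _ p q => fun v => sat p v -> sat q v
  | FAll _ p => fun v => forall x : L, sat p (env_cons x v)
  end.

Definition models d (L : orderType d) (p : formula 0) : Prop :=
  sat p (@env_nil L).

Definition elementarily_equivalent d (L : orderType d) d' (M : orderType d') :=
  forall p : formula 0, models L p <-> models M p.

Definition order_isomorphic d (L : orderType d) d' (M : orderType d') :=
  exists f : L -> M, bijective f /\ {mono f : x y / (x <= y)%O}.

Definition countably_categorical d (L : orderType d) : Prop :=
  countable [set: L] /\
  forall d' (M : orderType d'), countable [set: M] ->
    elementarily_equivalent M L -> order_isomorphic M L.

HB.structure Definition PreTopologicalGroup := {G of Group G & Topological G}.

HB.mixin Record PreTopologicalGroup_isTopologicalGroup G
    of PreTopologicalGroup G := {
  mulg_continuous : continuous (fun p : G * G => (p.1 * p.2)%g);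
  invg_continuous : continuous (fun x : G => x^-1%g)
}.

#[short(type="topologicalGroupType")]
HB.structure Definition TopologicalGroup :=
  {G of PreTopologicalGroup G & PreTopologicalGroup_isTopologicalGroup G}.

Definition continuous_action (G : topologicalGroupType) (X : topologicalType)
    (act : G -> X -> X) : Prop :=
  [/\ forall x, act 1%g x = x,
      forall g h x, act (g * h)%g x = act g (act h x)
    & continuous (fun p : G * X => act p.1 p.2)].

Definition extremely_amenable (G : topologicalGroupType) : Prop :=
  forall X : topologicalType,
    [set: X] !=set0 -> compact [set: X] -> hausdorff_space X ->
    forall act : G -> X -> X, continuous_action act ->
    exists x : X, forall g : G, act g x = x.

Record order_aut d (L : orderType d) := OrderAut {
  aut_fun :> L -> L;
  aut_bij : bijective aut_fun;
  aut_mono : {mono aut_fun : x y / (x <= y)%O}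
}.

Section OrderAut.
Context {d : Order.disp_t} {L : orderType d}.
Notation aut := (order_aut L).
Implicit Types f g h : aut.

HB.instance Definition _ := gen_eqMixin aut.
HB.instance Definition _ := gen_choiceMixin aut.

Lemma order_autP f g : f =1 g -> f = g.
Proof.
case: f g => [f fb fm] [g gb gm] /= /funext fg; subst g.
by rewrite (Prop_irrelevance fb gb) (Prop_irrelevance fm gm).
Qed.

Definition aut_one : aut := 
  @OrderAut _ L id (Bijective (fun _ => erefl) (fun _ => erefl))
    (fun _ _ => erefl).

Definition aut_mul f g : aut :=
  OrderAut (bij_comp (aut_bij f) (aut_bij g))
    (fun x y => etrans (aut_mono f (g x) (g y)) (aut_mono g x y)).

Lemma aut_inv_subproof f : exists g : L -> L, cancel f g /\ cancel g f.
Proof. by case: (aut_bij f) => g fK gK; exists g. Qed.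

Definition aut_inv_fun f : L -> L := sval (cid (aut_inv_subproof f)).

Lemma aut_funK f : cancel f (aut_inv_fun f).
Proof. by rewrite /aut_inv_fun; case: cid => g []. Qed.

Lemma aut_inv_funK f : cancel (aut_inv_fun f) f.
Proof. by rewrite /aut_inv_fun; case: cid => g []. Qed.

Lemma aut_inv_mono f : {mono aut_inv_fun f : x y / (x <= y)%O}.
Proof. by move=> x y; rewrite -(aut_mono f) !aut_inv_funK. Qed.

Definition aut_inv f : aut :=
  OrderAut (Bijective (aut_inv_funK f) (aut_funK f)) (@aut_inv_mono f).

Lemma aut_mulA : associative aut_mul.
Proof. by move=> f g h; apply: order_autP. Qed.

Lemma aut_mul1 : left_id aut_one aut_mul.
Proof. by move=> f; apply: order_autP. Qed.

Lemma aut_mulr1 : right_id aut_one aut_mul.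
Proof. by move=> f; apply: order_autP. Qed.

Lemma aut_mulV : left_inverse aut_one aut_inv aut_mul.
Proof. by move=> f; apply: order_autP => x; exact: aut_funK. Qed.

Lemma aut_mulrV : right_inverse aut_one aut_inv aut_mul.
Proof. by move=> f; apply: order_autP => x; exact: aut_inv_funK. Qed.

HB.instance Definition _ :=
  isGroup.Build aut aut_mulA aut_mul1 aut_mulr1 aut_mulV aut_mulrV.

(* Pointwise convergence is with respect to the discrete topology on L, not
   its order topology. *)
Definition aut_ptws f : {ptws L -> discrete_topology L} := aut_fun f.

HB.instance Definition _ := Topological.copy aut (initial_topology aut_ptws).

Lemma near_aut (f : aut) (x : L) : nbhs f [set g : aut | g x = f x].
Proof.
move: f; suff cx : continuous (fun g : aut => g x : discrete_topology L).
  by move=> f; apply: (cx f [set f x]); exact: discrete_set1.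
move=> f; apply: (@continuous_comp aut _ _ aut_ptws (@^~ x) f).
  exact: initial_continuous.
exact: (@proj_continuous _ (fun=> discrete_topology L) x).
Qed.

Lemma continuous_into_aut (X : topologicalType) (F : X -> aut) :
  (forall u x, nbhs u [set v | F v x = F u x]) -> continuous F.
Proof.
move=> FE; apply: continuous_comp_initial => u.
apply/cvg_sup => x; apply: continuous_comp_initial => {}u.
apply/discrete_cvg; exact: FE.
Qed.

Lemma aut_mul_continuous : continuous (fun p : aut * aut => (p.1 * p.2)%g).
Proof.
apply: continuous_into_aut => -[f g] x.
exists ([set f' : aut | f' (g x) = f (g x)], [set g' : aut | g' x = g x]).
  by split; exact: near_aut.
by move=> [f' g'] [/= ff' gg']; rewrite /= gg' ff'.
Qed.

Lemma aut_inv_continuous : continuous (fun f : aut => (f^-1)%g).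
Proof.
apply: continuous_into_aut => f x.
apply: filterS (near_aut f (aut_inv_fun f x)) => g /=.
by rewrite aut_inv_funK => gx; rewrite -[in LHS]gx; exact: aut_funK.
Qed.

HB.instance Definition _ := PreTopologicalGroup_isTopologicalGroup.Build aut
  aut_mul_continuous aut_inv_continuous.

End OrderAut.

(* Main.v *)
(* By a Ryll-Nardzewski argument Aut(L) has finitely many orbits on pairs: the
   ultrapower makes L saturated, hence isolated types are dense, hence an atomic
   elementary submodel exists, and it is isomorphic to L.

   Fix a flow X. For a convex C, let G_C be the group of automorphisms supported
   in C. By induction on the number of orbits of G_C on pairs of C, every closed
   nonempty G_C-invariant subset of X contains a G_C-fixed point. If C has a
   G_C-invariant cut, G_C is the product of the groups of its two halves.
   Otherwise let E be a maximal proper G_C-invariant convex equivalence relation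
   on C. Then C/E is dense without endpoints, and every orbit of G_C is dense in
   it. By induction and compactness there is a point y fixed by G_D for all
   classes D of E. Colouring the tuples of classes according to the position of the
   corresponding translates of y, Ramsey's theorem and the homogeneity of the
   coloured dense order C/E yield almost fixed points of any finite subset of
   G_C, hence a fixed point. *)

Require Import Defs.
From HB Require Import structures.
From mathcomp Require Import all_boot all_order.
From mathcomp Require Import boolp classical_sets functions cardinality filter.
From mathcomp Require Import topology function_spaces.

Set Implicit Arguments.
Unset Strict Implicit.
Unset Printing Implicit Defensive.

Import Order.TTheory.

(** Orbits on pairs matter because an invariant equivalence relation is a union of them: a maximal
    proper one therefore exists, and inside one of its classes strictly fewer pair colours occur,
    which makes the induction terminate. The model theory works with rank [k] Ehrenfeucht-Fraisse
    types instead of formulas: for fixed rank and length there are finitely many, so an ultrafilter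
    selects one of them and limits of types exist.

    In the dense case there are two obstacles. An element of G_C is not determined by its action on
    classes; fixing y by every G_D repairs this, since g^-1 y then depends, up to an element fixing
    a prescribed finite set of points, only on where g sends finitely many classes. And classes may
    lie in different G_C-orbits, so that arbitrary tuples of classes are not copies of one another.
    Here blocks are stacked above each other, each with one class from every orbit; an increasing
    sequence of block numbers then encodes a copy of a given tuple, and Ramsey's theorem for natural
    numbers suffices. *)

Lemma nat_dependent_choice (S : Type) (R : nat -> S -> S -> Prop) (s0 : S) :
  (forall n s, exists s', R n s s') ->
  exists f : nat -> S, f 0 = s0 /\ forall n, R n (f n) (f n.+1).
Proof.
move=> Rt; have /choice[F FP] (p : nat * S) := Rt p.1 p.2.
pose f := fix f n := if n is m.+1 then F (m, f m) else s0.
by exists f; split=> // n; exact: FP (n, f n).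
Qed.

(** * Back-and-forth systems on a countable order *)

Section BackAndForth.
Context {d : Order.disp_t} (L : orderType d).
Variables (P : seq (L * L) -> Prop) (s0 : seq (L * L)).
Hypothesis L_countable : countable [set: L].
Hypothesis P0 : P s0.
Hypothesis P_forth : forall s x, P s -> exists y, P ((x, y) :: s).
Hypothesis P_back : forall s y, P s -> exists x, P ((x, y) :: s).
Hypothesis P_mono : forall s p q, P s -> p \in s -> q \in s ->
  (p.1 <= q.1)%O = (p.2 <= q.2)%O.

(** The last clause keeps track of [P] along the limit, so that local properties, such as being the
    identity outside a convex set, pass to [g]. *)
Lemma back_and_forth : exists g : order_aut L,
  (forall p, p \in s0 -> g p.1 = p.2) /\
  forall x, exists2 s, P s & (x, g x) \in s.
Proof.
have /countable_injP[c c_inj] := L_countable.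
have {}c_inj : injective c by move=> x y; apply: c_inj; rewrite inE.
(* Step [n] treats the element coded [n], if there is one, both as an argument and as a value. *)
pose R n (s s' : {s | P s}) := {subset sval s <= sval s'} /\
  forall x, c x = n ->
    (exists y, (x, y) \in sval s') /\ (exists y, (y, x) \in sval s').
have Rt n s : exists s', R n s s'.
  case: (pselect (exists x, c x = n)) => [[x cx]|nx]; last first.
    by exists s; split=> // x cx; case: nx; exists x.
  have [y Py] := P_forth x (svalP s); have [z Pz] := P_back x Py.
  exists (exist _ _ Pz); split=> [p ps|x' cx'] /=.
    by rewrite !inE ps !orbT.
  have -> : x' = x by apply: c_inj; rewrite cx cx'.
  by split; [exists y|exists z]; rewrite !inE eqxx ?orbT.
have [f [f0 fR]] := nat_dependent_choice (exist _ _ P0) Rt.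
have f_mono m n : m <= n -> {subset sval (f m) <= sval (f n)}.
  elim: n => [|n IHn]; first by rewrite leqn0 => /eqP->.
  rewrite leq_eqVlt => /predU1P[->//|]; rewrite ltnS => /IHn mn p /mn.
  exact: (fR n).1.
pose gr x y := exists n, (x, y) \in sval (f n).
have gr_mono x y x' y' : gr x y -> gr x' y' -> (x <= x')%O = (y <= y')%O.
  move=> [m xy] [n xy']; apply: (P_mono (svalP (f (maxn m n)))
    (p := (x, y)) (q := (x', y'))).
    exact: (f_mono _ _ (leq_maxl _ _)).
  exact: (f_mono _ _ (leq_maxr _ _)).
have /choice[g gP] x : exists y, gr x y.
  by have [[y xy] _] := (fR (c x)).2 _ erefl; exists y, (c x).+1.
have /choice[h hP] y : exists x, gr x y.
  by have [_ [x xy]] := (fR (c y)).2 _ erefl; exists x, (c y).+1.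
have gr_fun x y z : gr x y -> gr x z -> y = z.
  by move=> xy xz; apply/le_anti; rewrite -(gr_mono _ _ _ _ xy xz)
    -(gr_mono _ _ _ _ xz xy) lexx.
have gr_inj x y z : gr x z -> gr y z -> x = y.
  by move=> xy xz; apply/le_anti; rewrite (gr_mono _ _ _ _ xy xz)
    (gr_mono _ _ _ _ xz xy) lexx.
have gh : cancel g h by move=> x; apply: gr_inj (hP _) (gP _).
have hg : cancel h g by move=> x; apply: gr_fun (gP _) (hP _).
have g_mono : {mono g : x y / (x <= y)%O} by move=> x y; apply/esym/gr_mono.
exists (OrderAut (Bijective gh hg) g_mono); split=> /= [[x y] xy|x].
  by apply: gr_fun (gP _) _; exists 0; rewrite f0.
by have [n xn] := gP x; exists (sval (f n)); first exact: svalP.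
Qed.

End BackAndForth.

(** * Types and the Ryll-Nardzewski theorem *)

Lemma env_cons0 (T : Type) n (x : T) (v : 'I_n -> T) : env_cons x v ord0 = x.
Proof. by rewrite /env_cons unlift_none. Qed.

Lemma env_cons_lift (T : Type) n (x : T) (v : 'I_n -> T) i :
  env_cons x v (lift ord0 i) = v i.
Proof. by rewrite /env_cons liftK. Qed.

Definition env_consE := (env_cons0, env_cons_lift).

Lemma ord_lift0P n (P : 'I_n.+1 -> Prop) :
  P ord0 -> (forall i, P (lift ord0 i)) -> forall i, P i.
Proof. by move=> P0 PS i; case: (unliftP ord0 i) => [j ->|->]. Qed.

Lemma env_cons_comp (T U : Type) n (f : T -> U) x (v : 'I_n -> T) :
  f \o env_cons x v = env_cons (f x) (f \o v).
Proof. by apply/funext; apply: ord_lift0P => [|i] /=; rewrite !env_consE. Qed.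

Definition lift_reindex m n (s : 'I_m -> 'I_n) : 'I_m.+1 -> 'I_n.+1 :=
  env_cons ord0 (lift ord0 \o s).

Lemma env_cons_reindex (T : Type) m n (s : 'I_m -> 'I_n) x (v : 'I_n -> T) :
  env_cons x (v \o s) = env_cons x v \o lift_reindex s.
Proof.
by apply/funext; apply: ord_lift0P => [|i] /=; rewrite /lift_reindex !env_consE.
Qed.

(* [tp le k v] is the rank k Ehrenfeucht-Fraisse type of the tuple v in the
   structure (Omega, le). *)
Fixpoint ty (k n : nat) : finType :=
  if k is k'.+1 then ({ffun 'I_n * 'I_n -> bool} * {set ty k' n.+1})%type
  else {ffun 'I_n * 'I_n -> bool}.

Definition diagram (O : Type) (le : rel O) n (v : 'I_n -> O) :=
  [ffun p : 'I_n * 'I_n => le (v p.1) (v p.2)].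

Fixpoint tp (O : Type) (le : rel O) k n (v : 'I_n -> O) : ty k n :=
  match k return ty k n with
  | 0 => diagram le v
  | k'.+1 =>
    (diagram le v, [set t | `[< exists x, tp le k' (env_cons x v) = t >]])
  end.

Section TypeTransfer.
Variables (O O' : Type) (le : rel O) (le' : rel O').

Lemma diagramP n (v : 'I_n -> O) (w : 'I_n -> O') :
  diagram le v = diagram le' w <->
  forall i j, le (v i) (v j) = le' (w i) (w j).
Proof.
split=> [/ffunP vw i j|vw]; first by have := vw (i, j); rewrite !ffunE.
by apply/ffunP => -[i j]; rewrite !ffunE.
Qed.

Lemma tpSP k n (v : 'I_n -> O) (w : 'I_n -> O') :
  tp le k.+1 v = tp le' k.+1 w <->
  [/\ diagram le v = diagram le' w,
      forall x, exists y, tp le k (env_cons x v) = tp le' k (env_cons y w) &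
      forall y, exists x, tp le k (env_cons x v) = tp le' k (env_cons y w)].
Proof.
split=> /= [[-> /setP vw]|[-> forth back]].
  split=> // [x|y].
    have := vw (tp le k (env_cons x v)); rewrite !inE => e.
    have /asboolP[y <-] : `[< exists y, tp le' k (env_cons y w) =
      tp le k (env_cons x v) >] by rewrite -e; apply/asboolP; exists x.
    by exists y.
  have := vw (tp le' k (env_cons y w)); rewrite !inE => e.
  have /asboolP[x xy] : `[< exists x, tp le k (env_cons x v) =
    tp le' k (env_cons y w) >] by rewrite e; apply/asboolP; exists y.
  by exists x.
congr (_, _); apply/setP => t; rewrite !inE; apply/asboolP/asboolP.
  by move=> [x <-]; have [y xy] := forth x; exists y.
by move=> [y <-]; have [x xy] := back y; exists x.
Qed.

Lemma tp_diagram k n (v : 'I_n -> O) (w : 'I_n -> O') :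
  tp le k v = tp le' k w -> diagram le v = diagram le' w.
Proof. by case: k => [//|k] /tpSP[]. Qed.

Lemma tp_le j k n (v : 'I_n -> O) (w : 'I_n -> O') :
  j <= k -> tp le k v = tp le' k w -> tp le j v = tp le' j w.
Proof.
elim: k j n v w => [|k IHk] j n v w; first by rewrite leqn0 => /eqP->.
case: j => [_|j jk /tpSP[vw forth back]]; first exact: tp_diagram.
apply/tpSP; split=> // [x|y].
  by have [y xy] := forth x; exists y; apply: IHk xy.
by have [x xy] := back y; exists x; apply: IHk xy.
Qed.

Lemma tp_reindex k m n (s : 'I_m -> 'I_n) (v : 'I_n -> O) (w : 'I_n -> O') :
  tp le k v = tp le' k w -> tp le k (v \o s) = tp le' k (w \o s).
Proof.
elim: k m n s v w => [|k IHk] m n s v w.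
  by move=> /diagramP vw; apply/diagramP => i j; exact: vw.
move=> /tpSP[/diagramP vw forth back]; apply/tpSP; split=> [|x|y].
- by apply/diagramP => i j; exact: vw.
- have [y xy] := forth x; exists y.
  by rewrite (env_cons_reindex s x) (env_cons_reindex s y); apply: IHk.
- have [x xy] := back y; exists x.
  by rewrite (env_cons_reindex s x) (env_cons_reindex s y); apply: IHk.
Qed.

(** Each of the [m] points of [s] is answered by one forth move and costs one unit of rank. The maps
    [a] and [b] record where the old coordinates sit in the longer tuple. *)
Lemma tp_extend m k n (s : 'I_m -> O) (v : 'I_n -> O) (w : 'I_n -> O') :
  tp le (k + m) v = tp le' (k + m) w ->
  exists N (v' : 'I_N -> O) (w' : 'I_N -> O') (a : 'I_m -> 'I_N)
    (b : 'I_n -> 'I_N),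
  [/\ tp le k v' = tp le' k w', s = v' \o a, v = v' \o b & w = w' \o b].
Proof.
elim: m n s v w => [|m IHm] n s v w.
  rewrite addn0 => vw; exists n, v, w, (@env_nil 'I_n).
  by exists id; split=> //; apply/funext => -[].
rewrite addnS => /tpSP[_ forth _]; have [y xy] := forth (s ord0).
have [N [v' [w' [a [b [vw' sE vE wE]]]]]] := IHm _ (s \o lift ord0) _ _ xy.
exists N, v', w', (env_cons (b ord0) a), (b \o lift ord0); split=> //.
- rewrite env_cons_comp -sE -[v' _]/((v' \o b) ord0) -vE env_cons0.
  by apply/funext; apply: ord_lift0P => [|i]; rewrite ?env_consE.
- by rewrite compA -vE; apply/funext => i; rewrite /= env_cons_lift.
- by rewrite compA -wE; apply/funext => i; rewrite /= env_cons_lift.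
Qed.

End TypeTransfer.

Section TypeCongruence.
Variables (O : Type) (le : rel O).
Hypotheses (le_refl : reflexive le) (le_trans : transitive le).

Lemma diagram_congr n (v w : 'I_n -> O) :
  (forall i, le (v i) (w i) && le (w i) (v i)) -> diagram le v = diagram le w.
Proof.
move=> vw; apply/diagramP => i j.
have /andP[a b] := vw i; have /andP[a' b'] := vw j.
apply/idP/idP => [vij|wij].
  exact: le_trans b (le_trans vij a').
exact: le_trans a (le_trans wij b').
Qed.

(** The ultrapower will be a mere preorder on sequences; this invariance stands in for passing to
    its quotient. *)
Lemma tp_congr k n (v w : 'I_n -> O) :
  (forall i, le (v i) (w i) && le (w i) (v i)) -> tp le k v = tp le k w.
Proof.
elim: k n v w => [|k IHk] n v w vw; first exact: diagram_congr.
have vwx x i : le (env_cons x v i) (env_cons x w i) &&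
    le (env_cons x w i) (env_cons x v i).
  by move: i; apply: ord_lift0P => [|i]; rewrite !env_consE ?le_refl.
by apply/tpSP; split=> [|x|x]; [exact: diagram_congr| |]; exists x; exact: IHk.
Qed.

End TypeCongruence.

Definition otp d (L : orderType d) k n (v : 'I_n -> L) := tp <=%O k v.

(** The rank is the quantifier depth of [p]. An equality atom is read off the diagram by
    antisymmetry in both orders. *)
Lemma otp_sat d (L : orderType d) d' (M : orderType d') n (p : formula n) :
  exists k, forall (v : 'I_n -> L) (w : 'I_n -> M), otp k v = otp k w ->
    (sat p v <-> sat p w).
Proof.
elim: p => {n} [n i j|n i j|n|n p [k IHp] q [l IHq]|n p [k IHp]].
- exists 0 => v w /diagramP vw; split=> /= [vij|wij]; apply/le_anti.
    by rewrite -!vw vij lexx.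
  by rewrite !vw wij lexx.
- by exists 0 => v w /diagramP vw /=; rewrite vw.
- by exists 0.
- exists (maxn k l) => v w vw /=.
  have vwk := IHp _ _ (tp_le (leq_maxl k l) vw).
  have vwl := IHq _ _ (tp_le (leq_maxr k l) vw).
  by split=> pq sp; apply/vwl/pq/vwk.
- exists k.+1 => v w /tpSP[_ forth back] /=; split=> pv.
    by move=> y; have [x /IHp xy] := back y; apply/xy/pv.
  by move=> x; have [y /IHp xy] := forth x; apply/xy/pv.
Qed.

Lemma otp_elementarily_equivalent d (L : orderType d) d' (M : orderType d') :
  (forall k, otp k (@env_nil L) = otp k (@env_nil M)) ->
  elementarily_equivalent L M.
Proof. by move=> LM p; have [k kP] := otp_sat L M p; exact: kP. Qed.

Lemma otp_iso d (L : orderType d) d' (M : orderType d') (f : L -> M) k n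
    (v : 'I_n -> L) :
  bijective f -> {mono f : x y / (x <= y)%O} -> otp k (f \o v) = otp k v.
Proof.
move=> [g fg gf] f_mono; elim: k n v => [|k IHk] n v.
  by apply/diagramP => i j; exact: f_mono.
apply/tpSP; split=> [|y|x]; first by apply/diagramP => i j; exact: f_mono.
  by exists (g y); rewrite -[y in LHS]gf -env_cons_comp; exact: IHk.
by exists (f x); rewrite -env_cons_comp; exact: IHk.
Qed.

(** * Countable elementary suborders of a total preorder *)

Section SubOrder.
Variables (O : Type) (le : rel O) (Q : O -> Prop).

(** [Q] selects at most one point from each class of a preorder, so that a genuine linear order
    arises without a quotient. The proof of these axioms is a parameter of the type, which lets the
    order instances recover it. *)
Definition suborder_axioms := [/\ reflexive le, transitive le, total le &
  forall x y, Q x -> Q y -> le x y -> le y x -> x = y].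

Definition suborder of suborder_axioms : Type := {x | Q x}.

Variable H : suborder_axioms.

HB.instance Definition _ := gen_eqMixin (suborder H).
HB.instance Definition _ := gen_choiceMixin (suborder H).

Definition suborder_le : rel (suborder H) := fun x y => le (sval x) (sval y).

Lemma suborder_refl : reflexive suborder_le.
Proof. move=> x; have [r _ _ _] := H; exact: r. Qed.

Lemma suborder_anti : antisymmetric suborder_le.
Proof.
move=> [x Qx] [y Qy]; have [_ _ _ a] := H; rewrite /suborder_le /= => /andP[xy yx].
by have e := a _ _ Qx Qy xy yx; subst y; rewrite (Prop_irrelevance Qx Qy).
Qed.

Lemma suborder_trans : transitive suborder_le.
Proof. move=> y x z; have [_ t _ _] := H; exact: t. Qed.

HB.instance Definition _ := Order.Le_isPOrder.Build (Order.Disp tt tt) (suborder H)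
  suborder_refl suborder_anti suborder_trans.

Lemma suborder_total : total (<=%O : rel (suborder H)).
Proof. move=> x y; have [_ _ t _] := H; exact: t. Qed.

HB.instance Definition _ :=
  Order.POrder_isTotal.Build (Order.Disp tt tt) (suborder H) suborder_total.

End SubOrder.

Section DownwardLowenheimSkolem.
Variables (O : choiceType) (le : rel O) (x0 : O) (good : seq O -> Prop).
Hypotheses (le_refl : reflexive le) (le_trans : transitive le).
Hypothesis le_total : total le.

Definition tup (s : seq O) (i : 'I_(size s)) : O := nth x0 s i.

Lemma env_cons_tup y s : env_cons y (tup (s := s)) = tup (s := y :: s).
Proof. by apply/funext; apply: ord_lift0P => [|i]; rewrite env_consE. Qed.

Lemma tup_reindex n (v : 'I_n -> O) s :
  (forall i, v i \in s) -> exists r : 'I_n -> 'I_(size s), v = tup (s := s) \o r.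
Proof.
move=> vs; have /choice[r rP] i : exists j : 'I_(size s), v i = tup j.
  have := vs i; rewrite -index_mem => vis.
  by exists (Ordinal vis); rewrite /tup nth_index.
by exists r; apply/funext.
Qed.

Hypothesis good_extend : forall s x k, good s -> exists y,
  good (y :: s) /\
  tp le k (env_cons y (tup (s := s))) = tp le k (env_cons x (tup (s := s))).

(** Only finitely many rank [k] types of one further point over [s] exist, so they are treated one
    at a time. Each is realized over the current, longer [s'], which keeps the sequence good, and
    then restricted to [s]. *)
Lemma good_realize s k : good s -> exists s',
  [/\ good s', {subset s <= s'} & forall x, exists2 y, y \in s' &
    tp le k (env_cons x (tup (s := s))) = tp le k (env_cons y (tup (s := s)))].
Proof.
move=> gs; suff: forall ts : seq (ty k (size s).+1), exists s',
    [/\ good s', {subset s <= s'} & forall x,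
      tp le k (env_cons x (tup (s := s))) \in ts -> exists2 y, y \in s' &
      tp le k (env_cons x (tup (s := s))) = tp le k (env_cons y (tup (s := s)))].
  by move=> /(_ (enum (ty k (size s).+1)))[s' [gs' ss' s'P]]; exists s';
    split=> // x; apply: s'P; rewrite mem_enum.
elim=> [|t ts [s' [gs' ss' s'P]]]; first by exists s; split.
case: (pselect (exists x, tp le k (env_cons x (tup (s := s))) = t)); last first.
  move=> nt; exists s'; split=> // x; rewrite inE => /predU1P[xt|].
    by case: nt; exists x.
  exact: s'P.
move=> [x <-]; have [y [gy yE]] := good_extend x k gs'.
exists (y :: s'); split=> // [z zs|z]; first by rewrite inE ss' ?orbT.
rewrite inE => /predU1P[->|/s'P[w ws' ->]].
  exists y; first by rewrite inE eqxx.
  have [|r rE] := @tup_reindex _ (tup (s := s)) s'.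
    by move=> i; apply/ss'/mem_nth.
  by rewrite rE (env_cons_reindex r x) (env_cons_reindex r y);
    apply: tp_reindex.
by exists w => //; rewrite inE ws' orbT.
Qed.

Variable s0 : seq O.
Hypothesis good0 : good s0.

(** The predicate [good] gives two uses: taken to be always true it yields an ordinary countable
    elementary submodel through [s0]; taken to say that a tuple is isolated it yields an atomic
    one. *)
Lemma downward_lowenheim_skolem :
  exists (M : orderType (Order.Disp tt tt)) (h : M -> O),
  [/\ countable [set: M],
      forall k n (v : 'I_n -> M), tp le k (h \o v) = otp k v,
      forall n (v : 'I_n -> M), exists2 s, good s & forall i, h (v i) \in s &
      forall x, x \in s0 -> exists m, le x (h m) && le (h m) x].
Proof.
(* Stage [n] realizes only rank [n] types. This is enough for the Tarski-Vaught test: a finite tuple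
   of the union lies in stages of arbitrarily high index, and high rank determines low rank. *)
pose R n (s s' : {s | good s}) := {subset sval s <= sval s'} /\
  forall x, exists2 y, y \in sval s' &
    tp le n (env_cons x (tup (s := sval s))) =
    tp le n (env_cons y (tup (s := sval s))).
have Rt n s : exists s', R n s s'.
  have [s' [gs' ss' s'P]] := good_realize n (svalP s).
  by exists (exist _ _ gs').
have [f [f0 fR]] := nat_dependent_choice (exist _ _ good0) Rt.
have f_mono m n : m <= n -> {subset sval (f m) <= sval (f n)}.
  elim: n => [|n IHn]; first by rewrite leqn0 => /eqP->.
  rewrite leq_eqVlt => /predU1P[->//|]; rewrite ltnS => /IHn mn p /mn.
  exact: (fR n).1.
pose A x := exists n, x \in sval (f n).
have A_common n (v : 'I_n -> O) k : (forall i, A (v i)) ->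
    exists2 N, k <= N & forall i, v i \in sval (f N).
  move=> /choice[N NP]; exists (maxn k (\max_i N i)); first exact: leq_maxl.
  move=> i; apply: f_mono (NP i); rewrite leq_max; apply/orP; right.
  exact: leq_bigmax.
(* [sim x] is the same set for equivalent points, so [rep] picks one point of [A] per class, and [Q]
   collects the points picked. *)
pose sim x := [set y | A y /\ le x y && le y x]%classic.
pose rep x := xget x0 (sim x).
have simE x y : le x y -> le y x -> sim x = sim y.
  move=> xy yx; apply/seteqP; split=> z [Az /andP[a b]]; split=> //.
    by rewrite (le_trans yx a) (le_trans b xy).
  by rewrite (le_trans xy a) (le_trans b yx).
have repP x : A x -> [/\ A (rep x), le x (rep x), le (rep x) x &
    rep (rep x) = rep x].
  move=> Ax; have /xgetI : sim x x by split=> //; rewrite le_refl.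
  move=> /(_ x0); rewrite -/(rep x) => -[Ar /andP[a b]]; split=> //.
  by rewrite [LHS]/rep (simE _ x).
pose Q x := A x /\ rep x = x.
have H : suborder_axioms le Q.
  split=> // x y [_ xE] [_ yE] xy yx.
  by rewrite -xE -yE /rep (simE x y).
exists (suborder H : orderType _), (fun x => sval x); split.
- have /countable_injP[c c_inj] : countable A.
    have -> : A = (\bigcup_n [set` sval (f n)])%classic.
      by apply/seteqP; split=> x [n]; [exists n|move=> _; exists n].
    by apply: bigcup_countable => // n _; apply: finite_set_countable.
  apply/countable_injP; exists (fun x => c (sval x)) => -[x Qx] [y Qy] _ _ /=.
  move=> xy; have e : x = y by apply: c_inj => //; rewrite inE; [case: Qx|case: Qy].
  by subst y; rewrite (Prop_irrelevance Qx Qy).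
- elim=> [|k IHk] n v; first by [].
  apply/tpSP; split=> // [x|y]; last first.
    by exists (sval y); rewrite -(env_cons_comp (fun x => sval x)); exact: IHk.
  have [|N kN vN] := A_common _ ((fun x => sval x) \o v) k.
    by move=> i; case: (svalP (v i)).
  have [r rE] := tup_reindex vN.
  have [y yN xy] := (fR N).2 x.
  have [Ar yr ry rr] : [/\ A (rep y), le y (rep y), le (rep y) y &
    rep (rep y) = rep y] by apply: repP; exists N.+1.
  have Qr : Q (rep y) by [].
  exists (exist Q _ Qr : suborder H); rewrite -[RHS]/(otp k _) -IHk env_cons_comp.
  transitivity (tp le k (env_cons y ((fun x => sval x) \o v))).
    rewrite rE (env_cons_reindex r x) (env_cons_reindex r y).
    by apply: tp_reindex; apply: tp_le kN xy.
  apply: tp_congr => //; apply: ord_lift0P => [|i]; rewrite !env_consE.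
    by rewrite yr ry.
  by rewrite le_refl.
- move=> n v; have [|N _ vN] := A_common _ ((fun x => sval x) \o v) 0.
    by move=> i; case: (svalP (v i)).
  by exists (sval (f N)); first exact: svalP.
- move=> x xs; have [|Ar xr rx rr] := repP x; first by exists 0; rewrite f0.
  have Qr : Q (rep x) by [].
  by exists (exist Q _ Qr : suborder H); rewrite /= xr rx.
Qed.

End DownwardLowenheimSkolem.

(** * Ultrafilter limits and ultrapowers *)

Lemma nat_ultrafilter :
  exists2 U : set_system nat, UltraFilter U & forall m, U [set n | m <= n]%classic.
Proof.
have [U [Uu Uoo]] := ultraFilterLemma eventually_filter.
by exists U => // m; apply: Uoo; exists m.
Qed.

Section UltraLimit.
Variables (I : Type) (U : set_system I).
Context {U_ultra : UltraFilter U}.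

Lemma ultra_ex A : U A -> exists i, A i.
Proof. by move=> UA; exact: filter_ex UA. Qed.

Lemma ultra_forall (T : finType) (P : T -> set I) :
  (forall t, U (P t)) -> U [set i | forall t, P t i]%classic.
Proof.
by move=> UP; apply: filter_forall => t; exact: UP.
Qed.

Lemma ultra_lim (T : finType) (f : I -> T) :
  exists t, U [set i | f i = t]%classic.
Proof.
apply: contrapT => /forallNP nf.
suff /ultra_ex[i /(_ (f i))] : U [set i | forall t, f i <> t]%classic by [].
apply: ultra_forall => t.
by have [/nf//|] := in_ultra_setVsetC [set i | f i = t]%classic U_ultra.
Qed.

End UltraLimit.

Section Ultrapower.
Context {d : Order.disp_t} (L : orderType d).
Variable U : set_system nat.
Hypothesis U_ultra : UltraFilter U.

Definition ultra_le : rel (nat -> L) :=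
  fun f g => `[< U [set i | (f i <= g i)%O]%classic >].

Lemma ultra_le_refl : reflexive ultra_le.
Proof.
by move=> f; apply/asboolP; apply: filterS filterT => i _ /=; exact: lexx.
Qed.

Lemma ultra_le_trans : transitive ultra_le.
Proof.
move=> g f h /asboolP fg /asboolP gh; apply/asboolP.
by apply: filterS2 fg gh => i; exact: le_trans.
Qed.

Lemma ultra_le_total : total ultra_le.
Proof.
move=> f g; have [fg|fg] :=
    in_ultra_setVsetC [set i | (f i <= g i)%O]%classic U_ultra.
  by apply/orP; left; apply/asboolP.
apply/orP; right; apply/asboolP; apply: filterS fg => i /= /negP.
by rewrite -ltNge => /ltW.
Qed.

(** The Los theorem with types in place of formulas. As there are finitely many values [t], it
    suffices to know for each single [t] that its being realized passes between the ultrapower and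
    almost all coordinates; a witness in the ultrapower is assembled coordinatewise. *)
Lemma los k n (v : 'I_n -> nat -> L) :
  U [set i | otp k (fun j => v j i) = tp ultra_le k v]%classic.
Proof.
have Ud m (w : 'I_m -> nat -> L) :
    U [set i | diagram <=%O (fun j => w j i) = diagram ultra_le w]%classic.
  suff: U [set i | forall p : 'I_m * 'I_m,
      (w p.1 i <= w p.2 i)%O = ultra_le (w p.1) (w p.2)]%classic.
    by apply: filterS => i wi; apply/diagramP => a b; exact: (wi (a, b)).
  apply: ultra_forall => -[a b] /=.
  rewrite /ultra_le; case: asboolP => [|nab].
    by apply: filterS => i ->.
  have [//|] :=
    in_ultra_setVsetC [set i | (w a i <= w b i)%O]%classic U_ultra.
  by apply: filterS => i /= /negP/negbTE.
elim: k n v => [|k IHk] n v; first exact: Ud.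
suff: U [set i | forall t : ty k n.+1,
    (exists x, otp k (env_cons x (fun j => v j i)) = t) <->
    (exists x, tp ultra_le k (env_cons x v) = t)]%classic.
  move=> Ut; apply: filterS2 (Ud _ v) Ut => i di ti /=; rewrite [LHS]/otp /= di.
  congr (_, _); apply/setP => t; rewrite !inE.
  by apply/asboolP/asboolP => /ti.
have envE x i : (fun j => env_cons x v j i) = env_cons (x i) (fun j => v j i).
  by apply/funext; apply: ord_lift0P => [|j]; rewrite !env_consE.
apply: ultra_forall => t.
case: (pselect (exists x, tp ultra_le k (env_cons x v) = t)) => [[x <-]|nt].
  apply: filterS (IHk _ (env_cons x v)) => i; rewrite /= envE => e.
  by split=> _; [exists x|exists (x i)].
have [Ut|] := in_ultra_setVsetC [set i |
    exists x, otp k (env_cons x (fun j => v j i)) = t]%classic U_ultra.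
  (* [y0] is a default value for the coordinates where [t] is not realized. *)
  case: nt; have [i0 [y0 _]] := ultra_ex Ut.
  have /choice[x xP] i : exists x,
      (exists y, otp k (env_cons y (fun j => v j i)) = t) ->
      otp k (env_cons x (fun j => v j i)) = t.
    case: (pselect (exists y, otp k (env_cons y (fun j => v j i)) = t)).
      by move=> [y yt]; exists y.
    by move=> ny; exists y0.
  exists x; have [i [it ix]] := ultra_ex (filterI Ut (IHk _ (env_cons x v))).
  by rewrite -ix envE; exact: xP.
by apply: filterS => i it; split=> [/it|/nt].
Qed.

End Ultrapower.

(** * Saturation, atomicity and homogeneity from categoricity *)

Section CountablyCategorical.
Context {d : Order.disp_t} (L : orderType d).
Hypothesis L_cat : countably_categorical L.
Variable x0 : L.

(** The countable elementary submodel of [O] is a copy of [L] by categoricity, so whatever was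
    arranged inside [O] can be read back in [L]. *)
Lemma categorical_realize (O : choiceType) (le : rel O) (good : seq O -> Prop)
    (o0 : O) (s0 : seq O) :
  reflexive le -> transitive le -> total le ->
  (forall k, tp le k (@env_nil O) = otp k (@env_nil L)) ->
  good s0 ->
  (forall s x k, good s -> exists y, good (y :: s) /\
    tp le k (env_cons y (tup o0 (s := s))) =
    tp le k (env_cons x (tup o0 (s := s)))) ->
  exists h : L -> O,
  [/\ forall k n (v : 'I_n -> L), tp le k (h \o v) = otp k v,
      forall n (v : 'I_n -> L), exists2 s, good s & forall i, h (v i) \in s &
      forall x, x \in s0 -> exists m, le x (h m) && le (h m) x].
Proof.
move=> le_refl le_trans le_total eqL gs0 ext.
have [M [h [cM hM gM sM]]] :=
  downward_lowenheim_skolem le_refl le_trans le_total ext gs0.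
have nilE (T T' : Type) (f : T -> T') : f \o @env_nil T = @env_nil T'.
  by apply/funext => -[].
have [|f [[g fg gf] f_mono]] := L_cat.2 _ M cM.
  by apply: otp_elementarily_equivalent => k; rewrite -hM nilE eqL.
have g_mono : {mono g : x y / (x <= y)%O} by move=> x y; rewrite -f_mono !gf.
exists (h \o g); split=> [k n v|n v|x /sM[m hm]].
- by rewrite -compA hM; apply: otp_iso => //; exists f.
- by have [s gs sP] := gM n (g \o v); exists s.
- by exists (f m); rewrite /= fg.
Qed.

(** Compactness of the space of types, with limits realized in [L] itself: the sequence of tuples is
    a tuple of the ultrapower, and a countable submodel containing it is a copy of [L]. *)
Lemma categorical_accumulation n (vs : nat -> 'I_n -> L) :
  exists v : 'I_n -> L, forall k m, exists2 i, m <= i & otp k v = otp k (vs i).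
Proof.
have [U Uu Uge] := nat_ultrafilter.
pose w (j : 'I_n) : nat -> L := fun i => vs i j.
have nilE i : (fun j => @env_nil (nat -> L) j i) = @env_nil L.
  by apply/funext => -[].
have [|||k||s x k _|h [hE _ hw]] :=
  @categorical_realize (nat -> L) (ultra_le U) (fun=> True) (fun=> x0) (codom w).
- exact: ultra_le_refl.
- exact: ultra_le_trans.
- exact: ultra_le_total.
- by have [i <-] := ultra_ex (los Uu k (@env_nil (nat -> L))); rewrite nilE.
- by [].
- by exists x.
have /choice[v vP] j : exists m, ultra_le U (w j) (h m) && ultra_le U (h m) (w j).
  by apply: hw; exact: codom_f.
exists v => k m; have [i [mi ik]] := ultra_ex (filterI (Uge m) (los Uu k w)).
exists i => //; rewrite -hE -[RHS]/(otp k (fun j => w j i)) ik; apply: tp_congr.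
- exact: ultra_le_refl.
- exact: ultra_le_trans.
- by move=> j; rewrite andbC; exact: vP.
Qed.

Definition isolated n (v : 'I_n -> L) :=
  exists k, forall w : 'I_n -> L, otp k w = otp k v -> forall j, otp j w = otp j v.

(* If no tuple of the same rank k type as v were isolated, one could refine
   that type step by step, avoiding the i-th tuple of L at step i; a tuple of L
   realizing the limit type would then avoid itself. *)
Lemma isolated_dense n (v : 'I_n -> L) k :
  exists2 w, isolated w & otp k w = otp k v.
Proof.
apply: contrapT => nw.
have /countable_injP[c c_inj] : countable [set: 'I_n -> L].
  have /countable_injP[c c_inj] := L_cat.1.
  apply/countable_injP; exists (fun w => pickle [ffun i => c (w i)]).
  move=> u w _ _ /(pcan_inj pickleK)/ffunP uw; apply/funext => i.
  by apply: c_inj; rewrite ?inE //; have := uw i; rewrite !ffunE.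
pose S := {p : ('I_n -> L) * nat |
  forall w, otp p.2 w = otp p.2 p.1 -> ~ isolated w}.
pose R i (p q : S) := [/\ (sval p).2 <= (sval q).2,
  otp (sval p).2 (sval q).1 = otp (sval p).2 (sval p).1 &
  forall t, c t = i -> otp (sval q).2 t <> otp (sval q).2 (sval q).1].
have Rt i p : exists q, R i p q.
  case: p => -[u l] /= ul.
  (* The tuple [u] has its own rank [l] type, hence is not isolated, so that type splits at a higher
     rank. Two different refinements cannot both agree with the tuple [t] to be avoided. *)
  have [w [j [wu wj]]] : exists (w : 'I_n -> L) j,
      otp l w = otp l u /\ otp j w <> otp j u.
    apply: contrapT => H; apply: (ul u erefl); exists l => w wu j.
    by apply: contrapT => wj; apply: H; exists w, j.
  pose m := maxn l j.
  have avoid (t : 'I_n -> L) : exists2 z : 'I_n -> L,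
      otp l z = otp l u & otp m t <> otp m z.
    have [tu|tu] := eqVneq (otp m t) (otp m u); last by exists u => //; exact/eqP.
    exists w => // tw; apply: wj.
    by apply: tp_le (leq_maxr l j) _; rewrite -/(otp m w) -tw.
  have next (z : 'I_n -> L) : otp l z = otp l u ->
      forall w, otp m w = otp m z -> ~ isolated w.
    by move=> zu w' wz; apply: ul; rewrite -zu; apply: tp_le wz; exact: leq_maxl.
  case: (pselect (exists t, c t = i)) => [[t ti]|ni].
    have [z zu tz] := avoid t; exists (exist _ (z, m) (next z zu)).
    split=> //=; first exact: leq_maxl.
    by move=> t' t'i; rewrite (c_inj t' t) ?inE // ti.
  exists (exist _ (u, m) (next u erefl)); split=> //=; first exact: leq_maxl.
  by move=> t ti; case: ni; exists t.
have p0 w : otp k w = otp k v -> ~ isolated w by move=> wv iw; apply: nw; exists w.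
have [f [_ fR]] := nat_dependent_choice (exist _ (v, k) p0 : S) Rt.
pose u i := (sval (f i)).1; pose l i := (sval (f i)).2.
have fE i j : i <= j -> l i <= l j /\ otp (l i) (u j) = otp (l i) (u i).
  elim: j => [|j IHj]; first by rewrite leqn0 => /eqP->.
  rewrite leq_eqVlt => /predU1P[->//|]; rewrite ltnS => /IHj[ij uij].
  have [jl ju _] := fR j; split; first exact: leq_trans ij jl.
  by rewrite -uij; apply: tp_le ju; exact: ij.
have [w wP] := categorical_accumulation u.
have [_ _ /(_ w erefl)] := fR (c w); apply.
by have [i ci ->] := wP (l (c w).+1) (c w).+1; rewrite -(fE _ _ ci).2.
Qed.

Lemma isolated_teq n (v w : 'I_n -> L) :
  (forall j, otp j w = otp j v) -> isolated v -> isolated w.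
Proof.
move=> wv [k kP]; exists k => u uw j; rewrite wv; apply: kP.
by rewrite uw wv.
Qed.

(** An isolated tuple [w] approximating [(x, v)] has a tail of the same type as [v], because [v] is
    isolated. A forth move from that tail back to [v], at a rank that isolates [w], gives [y]. *)
Lemma isolated_extend n (v : 'I_n -> L) x k : isolated v ->
  exists y, isolated (env_cons y v) /\
    otp k (env_cons y v) = otp k (env_cons x v).
Proof.
move=> [l lP]; have [w iw wx] := isolated_dense (env_cons x v) (maxn k l).
have wE : w = env_cons (w ord0) (w \o lift ord0).
  by apply/funext; apply: ord_lift0P => [|i]; rewrite env_consE.
have wv j : otp j (w \o lift ord0) = otp j v.
  apply: lP; have -> : v = env_cons x v \o lift ord0.
    by apply/funext => i; rewrite /= env_cons_lift.
  by apply: tp_reindex; apply: tp_le wx; exact: leq_maxr.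
have [m mP] := iw.
have /tpSP[_ forth _] := wv (maxn k m).+1; have [y yE] := forth (w ord0).
rewrite -wE in yE; exists y; split.
  apply: (isolated_teq _ iw); apply: mP; symmetry; apply: tp_le yE.
  exact: leq_maxr.
transitivity (otp k w); last by apply: tp_le wx; exact: leq_maxl.
by symmetry; apply: tp_le yE; exact: leq_maxl.
Qed.

(** If rank [k] isolates [v], rank [k + m] isolates its subtuples: the [m] additional ranks pay for
    completing a competitor to a full tuple of the type of [v]. *)
Lemma isolated_reindex m n (r : 'I_n -> 'I_m) (v : 'I_m -> L) :
  isolated v -> isolated (v \o r).
Proof.
move=> [k kP]; exists (k + m) => w /esym vw.
have [N [v' [w' [a [b [vw' vE vrE wE]]]]]] := tp_extend v vw.
have wv j : otp j (w' \o a) = otp j v.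
  by apply: kP; rewrite vE; apply/esym/tp_reindex.
suff -> : w = w' \o a \o r by move=> j; apply: tp_reindex; exact: wv.
have /diagramP vw0 := tp_diagram vw'.
apply/funext => i; rewrite wE /=; apply/le_anti; rewrite -!vw0.
have -> : v' (a (r i)) = v' (b i).
  by rewrite -[LHS]/((v' \o a) (r i)) -vE -[RHS]/((v' \o b) i) -vrE.
by rewrite lexx.
Qed.

(** [L] has an atomic elementary submodel, built from isolated finite tuples; being a copy of [L],
    it makes every tuple of [L] share its type with an isolated one. *)
Lemma categorical_isolated n (v : 'I_n -> L) : isolated v.
Proof.
have [|||k||s x k gs|h [hE hgood _]] := @categorical_realize L <=%O
  (fun s => isolated (tup x0 (s := s))) x0 [::].
- exact: lexx.
- exact: le_trans.
- exact: le_total.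
- by [].
- by exists 0 => w _ j; congr (otp j _); apply/funext => -[].
- by have [y [iy yx]] := isolated_extend x k gs; exists y; rewrite -env_cons_tup.
have [s gs sP] := hgood _ v; have [r rE] := tup_reindex x0 sP.
apply: (@isolated_teq _ (h \o v)) => [j|]; first by rewrite -hE.
by rewrite [h \o v]rE; exact: isolated_reindex.
Qed.

(** A compact space of isolated types is finite: tuples violating every rank would accumulate at
    some [u], and the rank isolating [u] would also isolate a tuple chosen to violate a rank at
    least as high. *)
Lemma categorical_rank n : exists k, forall v w : 'I_n -> L,
  otp k v = otp k w -> forall j, otp j v = otp j w.
Proof.
apply: contrapT => /forallNP nk.
pose bad k (v : 'I_n -> L) :=
  ~ forall w : 'I_n -> L, otp k w = otp k v -> forall j, otp j w = otp j v.
have /choice[v vP] k : exists v, bad k v.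
  apply: contrapT => /forallNP H; apply: (nk k) => w v wv.
  by have /contrapT := H v; apply.
have [u uP] := categorical_accumulation v.
have [k kP] := categorical_isolated u; have [i ki ui] := uP k k.
have vu j : otp j (v i) = otp j u by apply: kP.
apply: (vP i) => w wv j; rewrite vu; apply: kP; rewrite ui.
by apply: tp_le wv.
Qed.

Lemma teq_extend n (v w : 'I_n -> L) x : (forall j, otp j v = otp j w) ->
  exists y, forall j, otp j (env_cons x v) = otp j (env_cons y w).
Proof.
move=> vw; have [k kP] := categorical_rank n.+1.
have /tpSP[_ forth _] := vw k.+1; have [y xy] := forth x.
by exists y; exact: kP.
Qed.

Lemma teq_aut n (v w : 'I_n -> L) : (forall j, otp j v = otp j w) ->
  exists g : order_aut L, forall i, g (v i) = w i.
Proof.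
move=> vw; pose P (s : seq (L * L)) := exists m (a b : 'I_m -> L),
  (forall j, otp j a = otp j b) /\ forall p, p \in s -> exists i, p = (a i, b i).
have [|s x|s y|s p q|g [gE _]] :=
  @back_and_forth _ L P (codom (fun i => (v i, w i))) L_cat.1.
- by exists n, v, w; split=> // p /codomP[i ->]; exists i.
- move=> [m [a [b [ab sP]]]]; have [y xy] := teq_extend x ab; exists y.
  exists m.+1, (env_cons x a), (env_cons y b); split=> // p.
  rewrite inE => /predU1P[->|/sP[i ->]]; first by exists ord0; rewrite !env_consE.
  by exists (lift ord0 i); rewrite !env_consE.
- move=> [m [a [b [ab sP]]]].
  have [x xy] := teq_extend y (fun j => esym (ab j)); exists x.
  exists m.+1, (env_cons x a), (env_cons y b); split=> // p.
  rewrite inE => /predU1P[->|/sP[i ->]]; first by exists ord0; rewrite !env_consE.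
  by exists (lift ord0 i); rewrite !env_consE.
- move=> [m [a [b [ab sP]]]] /sP[i ->] /sP[j ->] /=.
  by have /diagramP := ab 0; apply.
by exists g => i; apply: (gE (v i, w i)); exact: codom_f (fun i => (v i, w i)) i.
Qed.

End CountablyCategorical.

(** Colours are rank [k] types of pairs, for the rank that determines the full type. Together with
    countability, this is all that the dynamical part uses of categoricity. *)
Lemma categorical_pair_orbits d (L : orderType d) : countably_categorical L ->
  exists (T : finType) (c : L -> L -> T), forall x y x' y', c x y = c x' y' ->
    exists g : order_aut L, g x = x' /\ g y = y'.
Proof.
move=> L_cat; case: (pselect (inhabited L)) => [[x0]|L0]; last first.
  by exists unit, (fun _ _ => tt) => x; case: L0.
have [k kP] := categorical_rank L_cat x0 2.
pose pair x y : 'I_2 -> L := env_cons x (env_cons y (@env_nil L)).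
exists (ty k 2), (fun x y => otp k (pair x y)) => x y x' y' /kP.
move=> /(teq_aut L_cat x0)[g gE]; exists g.
have := gE ord0; have := gE (lift ord0 ord0).
by rewrite /pair !env_consE.
Qed.

(** * Invariant convex equivalence relations *)

Section Supports.
Context {d : Order.disp_t} {L : orderType d}.
Notation aut := (order_aut L).
Implicit Types (g h : aut) (C D : set L).

Lemma autME g h x : (g * h)%g x = g (h x). Proof. by []. Qed.

Lemma autK g x : (g^-1)%g (g x) = x. Proof. exact: aut_funK. Qed.

Lemma autVK g x : g ((g^-1)%g x) = x. Proof. exact: aut_inv_funK. Qed.

Lemma aut_inj g : injective g. Proof. exact: can_inj (autK g). Qed.

Lemma aut_lt g : {mono g : x y / (x < y)%O}.
Proof. exact: leW_mono (aut_mono g). Qed.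

Definition convex C := forall x y z, C x -> C z -> (x <= y)%O -> (y <= z)%O -> C y.

Definition supp C g := forall x, ~ C x -> g x = x.

Lemma suppM C g h : supp C g -> supp C h -> supp C (g * h)%g.
Proof. by move=> gC hC x Cx; rewrite autME hC // gC. Qed.

Lemma suppV C g : supp C g -> supp C (g^-1)%g.
Proof. by move=> gC x Cx; rewrite -{1}(gC x Cx) autK. Qed.

Lemma supp_in C g x : supp C g -> C x -> C (g x).
Proof.
move=> gC Cx; apply: contrapT => /[dup] nC /gC/aut_inj gx.
by rewrite gx in nC.
Qed.

Lemma supp_subset C D g : (C `<=` D)%classic -> supp C g -> supp D g.
Proof. by move=> CD gC x Dx; apply: gC => /CD. Qed.

(** Gluing [g] on [D] with the identity elsewhere is monotone because [D] is convex: points outside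
    cannot separate [x] from [g x]. *)
Lemma restrict_aut D g : convex D ->
  (forall x, D x -> D (g x)) -> (forall x, D x -> D ((g^-1)%g x)) ->
  exists2 n : aut, supp D n & forall x, D x -> n x = g x.
Proof.
move=> cD gD gVD.
pose f (h : aut) x := if `[< D x >] then h x else x.
have fK h : (forall x, D x -> D (h x)) -> cancel (f h) (f h^-1%g).
  move=> hD x; rewrite /f; case: (asboolP (D x)) => Dx.
    by rewrite asboolT ?autK //; exact: hD.
  by rewrite asboolF.
have gg : cancel (f g) (f g^-1%g) by exact: fK.
have gg' : cancel (f g^-1%g) (f g) by rewrite -{2}[g]invgK; exact: fK.
have f_mono : {mono (f g) : x y / (x <= y)%O}.
  move=> x y; rewrite /f; case: asboolP => Dx; case: asboolP => Dy //.
  - exact: aut_mono.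
  - apply/idP/idP => xy; case: leP => // yx; case: Dy.
      exact: cD (gD _ Dx) Dx xy (ltW yx).
    exact: cD Dx (gD _ Dx) xy (ltW yx).
  - apply/idP/idP => xy; case: leP => // yx; case: Dx.
      exact: cD Dy (gD _ Dy) (ltW yx) xy.
    exact: cD (gD _ Dy) Dy (ltW yx) xy.
exists (OrderAut (Bijective gg gg') f_mono) => x Dx /=.
  by rewrite /f asboolF.
by rewrite /f asboolT.
Qed.

End Supports.

Section ConvexCongruence.
Context {d : Order.disp_t} {L : orderType d}.
Notation aut := (order_aut L).
Variable C : set L.

Record convex_congruence (E : L -> L -> Prop) : Prop := ConvexCongruence {
  cc_in : forall x y, E x y -> C x /\ C y;
  cc_refl : forall x, C x -> E x x;
  cc_sym : forall x y, E x y -> E y x;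
  cc_trans : forall y x z, E x y -> E y z -> E x z;
  cc_convex : forall x y z, E x z -> (x <= y)%O -> (y <= z)%O -> E x y;
  cc_inv : forall (g : aut) x y, supp C g -> E x y -> E (g x) (g y)
}.

Definition proper_rel (E : L -> L -> Prop) :=
  exists x y, [/\ C x, C y & ~ E x y].

Variable E : L -> L -> Prop.
Hypothesis cE : convex_congruence E.

(** The strict order of the quotient C/E, read on representatives. *)
Definition ltE x y := [/\ C x, C y, (x < y)%O & ~ E x y].

Lemma ltE_or x y : C x -> C y -> [\/ E x y, ltE x y | ltE y x].
Proof.
move=> Cx Cy; case: (pselect (E x y)) => [|nE]; first by constructor 1.
case: (ltgtP x y) => [xy|yx|xy]; first by constructor 2.
  by constructor 3; split=> // /(cc_sym cE).
by case: nE; rewrite xy; exact: (cc_refl cE).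
Qed.

Lemma ltE_irr x y : ltE x y -> E x y -> False.
Proof. by case. Qed.

Lemma ltE_asym x y : ltE x y -> ltE y x -> False.
Proof. by move=> [_ _ xy _] [_ _ /(lt_trans xy)]; rewrite ltxx. Qed.

Lemma ltE_l x x' y : E x x' -> ltE x y -> ltE x' y.
Proof.
move=> xx' [Cx Cy xy nE]; have [_ Cx'] := cc_in cE xx'.
split=> //; last by move=> x'y; apply: nE; exact: (cc_trans cE) xx' x'y.
by case: ltP => // yx'; case: nE; exact: (cc_convex cE) xx' (ltW xy) yx'.
Qed.

Lemma ltE_r x y y' : E y y' -> ltE x y -> ltE x y'.
Proof.
move=> yy' [Cx Cy xy nE]; have [_ Cy'] := cc_in cE yy'.
split=> //; last first.
  by move=> xy'; apply: nE; exact: (cc_trans cE) xy' (cc_sym cE yy').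
case: ltP => // y'x; case: nE; apply: (cc_sym cE).
apply: (cc_trans cE yy').
exact: (cc_convex cE) (cc_sym cE yy') y'x (ltW xy).
Qed.

Lemma le_ltE x y z : C x -> (x <= y)%O -> ltE y z -> ltE x z.
Proof.
move=> Cx xy [Cy Cz yz nE]; split=> //; first exact: le_lt_trans xy yz.
move=> xz; apply: nE; apply: (cc_trans cE _ xz); apply: (cc_sym cE).
exact: (cc_convex cE) xz xy (ltW yz).
Qed.

Lemma ltE_le x y z : C z -> ltE x y -> (y <= z)%O -> ltE x z.
Proof.
move=> Cz [Cx Cy xy nE] yz; split=> //; first exact: lt_le_trans xy yz.
by move=> xz; apply: nE; exact: (cc_convex cE) xz (ltW xy) yz.
Qed.

Lemma ltE_trans y x z : ltE x y -> ltE y z -> ltE x z.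
Proof. by move=> xy [_ Cz yz _]; apply: ltE_le xy (ltW yz). Qed.

Lemma ltE_aut (g : aut) x y : supp C g -> ltE x y -> ltE (g x) (g y).
Proof.
move=> gC [Cx Cy xy nE]; split; rewrite ?aut_lt //; try exact: supp_in.
by move=> /(cc_inv cE (suppV gC)); rewrite !autK.
Qed.

Lemma class_convex x : convex (E x).
Proof.
move=> a b c xa xc ab bc; apply: (cc_trans cE xa).
exact: (cc_convex cE (cc_trans cE (cc_sym cE xa) xc) ab bc).
Qed.

Lemma class_subset x : (E x `<=` C)%classic.
Proof. by move=> y /(cc_in cE)[]. Qed.

Lemma class_restrict (g : aut) x : supp C g -> E x (g x) ->
  exists2 n : aut, supp (E x) n & forall y, E x y -> n y = g y.
Proof.
move=> gC xg; apply: restrict_aut => [|y xy|y xy]; first exact: class_convex.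
  exact: (cc_trans cE) xg (cc_inv cE gC xy).
have := cc_inv cE (suppV gC) (cc_trans cE (cc_sym cE xg) xy).
by rewrite autK.
Qed.

Lemma class_repr (x0 : L) : exists cl : L -> L,
  (forall x, C x -> E x (cl x)) /\ (forall x y, E x y -> cl x = cl y).
Proof.
exists (fun x => xget x0 [set y | E x y]%classic); split=> [x Cx|x y xy].
  by apply: (@xgetI _ _ [set y | E x y]%classic x); exact: (cc_refl cE).
congr xget; apply/seteqP; split=> z /= h.
  exact: (cc_trans cE (cc_sym cE xy) h).
exact: (cc_trans cE xy h).
Qed.

End ConvexCongruence.

(** * Congruences and colours of pairs *)

Section PairHomogeneous.
Context {d : Order.disp_t} {L : orderType d}.
Notation aut := (order_aut L).
Variables (T : finType) (c : L -> L -> T).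

Definition pair_homogeneous (C : set L) := forall x y x' y',
  C x -> C y -> C x' -> C y' -> c x y = c x' y' ->
  exists g : aut, [/\ supp C g, g x = x' & g y = y'].

Variable C : set L.
Hypothesis cC : pair_homogeneous C.

(** By homogeneity a congruence contains every pair of [C] sharing a colour with one of its pairs,
    so it is determined by its set of colours; a proper one with the most colours is maximal. *)
Lemma maximal_congruence :
  (exists2 E, convex_congruence C E & proper_rel C E) ->
  exists E, [/\ convex_congruence C E, proper_rel C E &
    forall E', convex_congruence C E' -> proper_rel C E' ->
      (forall x y, E x y -> E' x y) -> forall x y, E' x y -> E x y].
Proof.
pose colors (E : L -> L -> Prop) : {set T} :=
  [set t | `[< exists x y, E x y /\ c x y = t >]].
pose P n := `[< exists E, [/\ convex_congruence C E, proper_rel C E &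
  #|colors E| = n] >].
move=> [E0 cE0 pE0]; have exP : exists n, P n.
  by exists #|colors E0|; apply/asboolP; exists E0.
have Pmax n : P n -> n <= #|T| by move=> /asboolP[E [_ _ <-]]; exact: max_card.
case: (ex_maxnP exP Pmax) => n /asboolP[E [cE pE <-]] maxE.
exists E; split=> // E' cE' pE' EE' x y xy.
have sub : colors E \subset colors E'.
  apply/fintype.subsetP => t; rewrite !inE => -[a [b [ab t_ab]]].
  by exists a, b; split=> //; exact: EE'.
have /eqP eq_col : colors E == colors E'.
  have PE' : P #|colors E'| by apply/asboolP; exists E'.
  by rewrite eqEcard sub maxE.
have : c x y \in colors E' by rewrite !inE; exists x, y.
rewrite -eq_col !inE => -[a [b [ab ab_xy]]].
have [Ca Cb] := cc_in cE ab; have [Cx Cy] := cc_in cE' xy.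
have [g [gC <- <-]] := cC Ca Cb Cx Cy ab_xy.
exact: (cc_inv cE).
Qed.

Lemma class_pair_homogeneous E x : convex_congruence C E ->
  pair_homogeneous (E x).
Proof.
move=> cE a b a' b' xa xb xa' xb' ab.
have [||||g [gC ga gb]] := cC _ _ _ _ ab; try by case: (cc_in cE xa) (cc_in cE xb)
  (cc_in cE xa') (cc_in cE xb') => [? ?] [? ?] [? ?] [? ?].
have xg : E x (g x).
  by apply: (cc_trans cE xa'); apply: (cc_sym cE); rewrite -ga; exact: (cc_inv cE).
have [n nx nE] := class_restrict cE gC xg.
by exists n; rewrite !nE.
Qed.

(** The colour of a pair not related by [E] cannot occur inside a class, since an element of G_C
    would carry the one pair to the other. This strict loss drives the final induction. *)
Lemma class_colors E x (A : {set T}) :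
  convex_congruence C E -> proper_rel C E ->
  (forall a b, C a -> C b -> c a b \in A) ->
  exists2 A' : {set T}, #|A'| < #|A| &
    forall a b, E x a -> E x b -> c a b \in A'.
Proof.
move=> cE [a [b [Ca Cb nab]]] CA.
exists [set t in A | `[< exists x y, E x y /\ c x y = t >]].
  apply: proper_card; rewrite properE; apply/andP; split.
    by apply/fintype.subsetP => t; rewrite !inE => /andP[].
  apply/fintype.subsetPn; exists (c a b); first exact: CA.
  rewrite !inE CA //=; apply/asboolP => -[a' [b' [ab' e]]].
  have [Ca' Cb'] := cc_in cE ab'; have [g [gC ga gb]] := cC Ca' Cb' Ca Cb e.
  by apply: nab; rewrite -ga -gb; exact: (cc_inv cE).
move=> y z xy xz; rewrite !inE CA ?(cc_in cE xy).2 ?(cc_in cE xz).2 //=.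
  apply/asboolP; exists y, z; split=> //.
  exact: (cc_trans cE (cc_sym cE xy) xz).
by have [_ ?] := cc_in cE xy.
by have [_ ?] := cc_in cE xz.
Qed.

Definition invariant_cut (I : set L) :=
  [/\ (I `<=` C)%classic, forall x y, I y -> C x -> (x <= y)%O -> I x,
      forall (g : aut) x, supp C g -> I x -> I (g x) & I !=set0%classic].

Lemma cut_congruence I : convex C -> invariant_cut I ->
  convex_congruence C (fun x y => [/\ C x, C y & I x <-> I y]).
Proof.
move=> cvC [IC Idown Iinv _]; split.
- by move=> x y [].
- by move=> x Cx; split.
- by move=> x y [Cx Cy xy]; split=> //; split=> /xy.
- by move=> y x z [Cx Cy xy] [_ Cz yz]; split=> //; split=> [/xy/yz|/yz/xy].
- move=> x y z [Cx Cz xz] xy yz; have Cy := cvC _ _ _ Cx Cz xy yz.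
  split=> //; split=> [/xz Iz|Iy]; [exact: Idown Iz Cy yz|exact: Idown Iy Cx xy].
- move=> g x y gC [Cx Cy xy]; split; try exact: supp_in.
  split=> /(Iinv _ _ (suppV gC)); by rewrite autK => /xy; exact: Iinv.
Qed.

Definition no_cut := forall I, invariant_cut I -> (C `<=` I)%classic.

Lemma no_cut_up : no_cut -> forall J : set L,
  (J `<=` C)%classic -> (forall x y, J x -> C y -> (x <= y)%O -> J y) ->
  (forall (g : aut) x, supp C g -> J x -> J (g x)) -> J !=set0%classic ->
  (C `<=` J)%classic.
Proof.
move=> nc J JC Jup Jinv [x0 Jx0] x Cx; apply: contrapT => nJx.
have /nc : invariant_cut (C `\` J)%classic; last by move=> /(_ x0 (JC _ Jx0))[].
split=> [y []//|a b [Cb nJb] Ca ab|g a gC [Ca nJa]|]; last by exists x.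
  by split=> // Ja; apply: nJb; exact: Jup Ja Cb ab.
split; first exact: supp_in.
by move=> /(Jinv _ _ (suppV gC)); rewrite autK.
Qed.

(** * The quotient by a maximal congruence *)

Section MaximalCongruence.
Variable E : L -> L -> Prop.
Hypotheses (cE : convex_congruence C E) (pE : proper_rel C E) (nc : no_cut).
Hypothesis E_max : forall E', convex_congruence C E' -> proper_rel C E' ->
  (forall x y, E x y -> E' x y) -> forall x y, E' x y -> E x y.
Notation ltE := (ltE C E).

Lemma proper_ltE : exists x y, ltE x y.
Proof.
have [x [y [Cx Cy nE]]] := pE.
by case: (ltE_or cE Cx Cy) => [//|xy|yx]; [exists x, y|exists y, x].
Qed.

(** The points lying below some translate of [w] form an invariant initial segment, which is all of
    [C] as soon as it is nonempty. *)
Lemma orbit_cofinal z w : C z -> C w -> exists2 g : aut, supp C g & ltE z (g w).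
Proof.
move=> Cz Cw.
pose I x := exists2 g : aut, supp C g & ltE x (g w).
case: (pselect (exists x, I x)) => [I0|nI].
  apply: (nc (I := I)) => //; split=> // [x [g _ []]//|x y [g gC yg] Cx xy|h x hC].
    by exists g => //; exact: (le_ltE cE) xy yg.
  move=> [g gC xg]; exists (h * g)%g; first exact: suppM.
  exact: (ltE_aut cE hC xg).
(* Otherwise every translate of [w] lies in a lowest class; the classes met by the orbit form an
   invariant cut, hence exhaust [C], against [ltE x y]. *)
have [x [y xy]] := proper_ltE; have [Cx Cy _ _] := xy.
pose J x := exists2 g : aut, supp C g & E x (g w).
suff /(_ y Cy)[g gC yg] : (C `<=` J)%classic.
  by case: nI; exists x, g => //; exact: (ltE_r cE) yg xy.
apply: nc; split=> [a [g _ /(cc_in cE)[]]//|a b [g gC bg] Ca ab|h a hC [g gC ag]|].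
- case: (ltE_or cE Ca (cc_in cE bg).2) => [|ag|ga]; first by exists g.
    by case: nI; exists a, g.
  have := le_ltE cE Ca ab (ltE_l cE (cc_sym cE bg) ga).
  by move=> [_ _]; rewrite ltxx.
- by exists (h * g)%g; [exact: suppM|exact: (cc_inv cE hC ag)].
- by exists w, 1%g => //; exact: (cc_refl cE).
Qed.

Lemma orbit_coinitial z w : C z -> C w -> exists2 g : aut, supp C g & ltE (g w) z.
Proof.
move=> Cz Cw.
pose I x := exists2 g : aut, supp C g & ltE (g w) x.
case: (pselect (exists x, I x)) => [I0|nI].
  apply: (no_cut_up nc (J := I)) => // [x [g _ []]//|x y [g gC xg] Cy xy|h x hC].
    by exists g => //; exact: (ltE_le cE) xg xy.
  move=> [g gC xg]; exists (h * g)%g; first exact: suppM.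
  exact: (ltE_aut cE hC xg).
have [x [y xy]] := proper_ltE; have [Cx Cy _ _] := xy.
pose J x := exists2 g : aut, supp C g & E x (g w).
suff /(_ x Cx)[g gC xg] : (C `<=` J)%classic.
  by case: nI; exists y, g => //; exact: (ltE_l cE) xg xy.
apply: (no_cut_up nc) =>
    [a [g _ /(cc_in cE)[]]//|a b [g gC ag] Cb ab|h a hC [g gC ag]|].
- case: (ltE_or cE (cc_in cE ag).2 Cb) => [gb|gb|bg].
  + by exists g => //; exact: (cc_sym cE).
  + by case: nI; exists b, g.
  + have := ltE_le cE Cb (ltE_r cE (cc_sym cE ag) bg) ab.
    by move=> [_ _]; rewrite ltxx.
- by exists (h * g)%g; [exact: suppM|exact: (cc_inv cE hC ag)].
- by exists w, 1%g => //; exact: (cc_refl cE).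
Qed.

Definition between (a z b : L) := (a <= z <= b)%O \/ (b <= z <= a)%O.

Lemma between_sym a z b : between a z b -> between b z a.
Proof. by case; [right|left]. Qed.

Lemma between_left a b : between a a b.
Proof. by case: (leP a b) => [h|/ltW h]; [left|right]; rewrite lexx h. Qed.

Lemma between_right a b : between a b b.
Proof. exact/between_sym/between_left. Qed.

Lemma between_split a b e z : between a z e -> between a z b \/ between b z e.
Proof.
rewrite /between => -[/andP[az ze]|/andP[ez za]].
  by case: (leP z b) => [zb|/ltW bz]; [left; left|right; left]; apply/andP.
by case: (leP z b) => [zb|/ltW bz]; [right; right|left; right]; apply/andP.
Qed.

Lemma between_subinterval a b e z :
  (a <= b)%O -> (b <= e)%O -> between a z b -> between a z e.
Proof.
move=> ab be [/andP[az zb]|/andP[bz za]]; left; apply/andP; split=> //.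
- exact: le_trans zb be.
- exact: le_trans ab bz.
- exact: le_trans za (le_trans ab be).
Qed.

Lemma between_C a z b : convex C -> C a -> C b -> between a z b -> C z.
Proof.
by move=> cvC Ca Cb [/andP[]|/andP[]]; [exact: cvC Ca Cb|exact: cvC Cb Ca].
Qed.

Lemma between_E a z b : E a b -> between a z b -> E a z.
Proof.
move=> ab [/andP[az zb]|/andP[bz za]]; first exact: (cc_convex cE) ab az zb.
apply: (cc_trans cE ab); exact: (cc_convex cE) (cc_sym cE ab) bz za.
Qed.

Lemma between_autV (h : aut) a z b :
  between (h a) z (h b) -> between a ((h^-1)%g z) b.
Proof.
by rewrite /between -[z in X in X -> _](autVK h) !aut_mono.
Qed.

Hypothesis cvC : convex C.

(* A class and its immediate successor have the same stabilizer, so density of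
   the quotient follows once this congruence is shown to be trivial. *)
Definition stab_eq a b := [/\ C a, C b & forall z, between a z b ->
  forall g : aut, supp C g -> E z (g z) <-> E a (g a)].

Lemma stab_eq_of_E a b (g : aut) : supp C g -> E a b -> E b (g b) <-> E a (g a).
Proof.
move=> gC ab; split=> e.
  apply: (cc_trans cE ab); apply: (cc_trans cE e).
  by apply: (cc_sym cE); exact: (cc_inv cE).
apply: (cc_trans cE (cc_sym cE ab)); apply: (cc_trans cE e).
exact: (cc_inv cE).
Qed.

Lemma stab_eq_congruence : convex_congruence C stab_eq.
Proof.
split.
- by move=> x y [].
- move=> x Cx; split=> // z [] /andP[a b] g _;
    by have -> : z = x by apply/le_anti; rewrite a b.
- move=> x y [Cx Cy xy]; split=> // z /between_sym xzy g gC.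
  have -> := xy z xzy g gC; apply: iff_sym; apply: xy => //.
  exact: between_right.
- move=> y x z [Cx Cy xy] [_ Cz yz]; split=> // w /(between_split y)[|] wB g gC.
    exact: xy.
  have -> := yz w wB g gC; apply: xy => //.
  exact: between_right.
- move=> x y z [Cx Cz xz] xy yz; split=> //; first exact: cvC Cx Cz xy yz.
  move=> w wB; apply: xz; exact: between_subinterval xy yz wB.
- move=> h x y hC [Cx Cy xy]; split; try exact: supp_in.
  move=> z /between_autV zB g gC.
  have ghC : supp C (h^-1 * g * h)%g.
    exact: suppM (suppM (suppV hC) gC) hC.
  have := xy _ zB _ ghC; rewrite !autME autVK => e.
  have conj a b : E (h^-1 a)%g (h^-1 b)%g <-> E a b.
    split=> [/(cc_inv cE hC)|ab]; first by rewrite !autVK.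
    exact: (cc_inv cE (suppV hC)).
  by rewrite -conj e -[X in E X _](autK h) conj.
Qed.

(** If all classes had one stabilizer, take more than [#|T|] points in increasing classes. Two of
    them get the same colour relative to [x], and an element fixing [x] then moves one to the
    other. *)
Lemma stab_eq_proper : proper_rel C stab_eq.
Proof.
apply: contrapT => np.
have allC x y : C x -> C y -> stab_eq x y.
  by move=> Cx Cy; apply: contrapT => nxy; apply: np; exists x, y.
have [x [_ [Cx _ _]]] := pE.
have [f [f0 fS]] : exists f : nat -> {y | C y},
    f 0 = exist C x Cx /\ forall n, ltE (sval (f n)) (sval (f n.+1)).
  apply: (@nat_dependent_choice _ (fun _ a b => ltE (sval a) (sval b))) => _ a.
  have [g gC ag] := orbit_cofinal (svalP a) Cx.
  by exists (exist C _ (supp_in gC Cx)).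
have f_lt i j : i < j -> ltE (sval (f i)) (sval (f j)).
  elim: j => // j IHj; rewrite ltnS leq_eqVlt => /predU1P[->//|/IHj ij].
  exact: (ltE_trans cE) ij (fS j).
have /injectivePn[i [j nij /esym cij]] : ~~ injectiveb
    (fun i : 'I_#|T|.+1 => c x (sval (f i))).
  apply/negP => /injectiveP /leq_card; rewrite card_ord ltnn.
  by [].
wlog ij : i j nij cij / i < j.
  move=> H; case: (ltngtP i j) => [|ji|/val_inj ij]; first exact: H.
    by apply: (H j i) ji; rewrite // eq_sym.
  by rewrite ij eqxx in nij.
have [g [gC gx gi]] := cC Cx (svalP (f i)) Cx (svalP (f j)) (esym cij).
have [_ _ /(_ (sval (f i)) _ g gC)] := allC x (sval (f i)) Cx (svalP _).
rewrite gx gi => H; have [_ _ _] := f_lt _ _ ij; apply; apply/H.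
  exact: between_right.
exact: (cc_refl cE).
Qed.

(** An element of G_C fixing one of two adjacent classes fixes the other, so adjacent [a] and [b]
    would be related by [stab_eq], which is contained in [E] by maximality. *)
Lemma quotient_dense a b : ltE a b -> exists2 z, ltE a z & ltE z b.
Proof.
move=> ab; apply: contrapT => nz; have [Ca Cb lt_ab nE] := ab.
apply: nE; apply: E_max stab_eq_congruence stab_eq_proper _ _ _ _ => [x y xy|].
  have [Cx Cy] := cc_in cE xy; split=> // z zB g gC.
  exact: stab_eq_of_E gC (between_E xy zB).
have nz' z : ltE a z -> ltE z b -> False by move=> az zb; apply: nz; exists z.
split=> // z zB g gC; have Cz := between_C cvC Ca Cb zB.
case: (ltE_or cE Ca Cz) => [az|az|za]; first exact: stab_eq_of_E.
  case: (ltE_or cE Cz Cb) => [zb|/(nz' z az)//|bz]; last first.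
    case: zB => /andP[u v].
      have [_ _ w _] := bz.
      by have := le_lt_trans v w; rewrite ltxx.
    by have := le_trans u v; rewrite leNgt lt_ab.
  rewrite -(stab_eq_of_E gC zb).
  have Cga := supp_in gC Ca; have Cgb := supp_in gC Cb.
  have gVC := suppV gC.
  have Cga' := supp_in gVC Ca; have Cgb' := supp_in gVC Cb.
  (* If [g] fixes one of the two classes and moves the other, the translate of the moved one by [g]
     or by its inverse falls strictly between them; hence the passage to inverses. *)
  have VE x : E x (g x) -> E x ((g^-1)%g x).
    by move=> /(cc_inv cE gVC); rewrite autK => /(cc_sym cE).
  have EV x : E x ((g^-1)%g x) -> E x (g x).
    by move=> /(cc_inv cE gC); rewrite autVK => /(cc_sym cE).
  have gab := ltE_aut cE gC ab; have gVab := ltE_aut cE gVC ab.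
  split=> e.
    case: (ltE_or cE Ca Cga) => [//|aga|gaa].
      by case: (nz' _ aga (ltE_r cE (cc_sym cE e) gab)).
    apply: EV; have := ltE_aut cE gVC gaa; rewrite autK => aVa.
    by case: (nz' _ aVa (ltE_r cE (cc_sym cE (VE _ e)) gVab)).
  case: (ltE_or cE Cb Cgb) => [//|bgb|gbb]; last first.
    by case: (nz' _ (ltE_l cE (cc_sym cE e) gab) gbb).
  apply: EV; have := ltE_aut cE gVC bgb; rewrite autK => Vbb.
  by case: (nz' _ (ltE_l cE (cc_sym cE (VE _ e)) gVab) Vbb).
case: zB => /andP[u v]; last by have := le_trans u v; rewrite leNgt lt_ab.
by have [_ _ w _] := za; have := le_lt_trans u w; rewrite ltxx.
Qed.

(** Having no point of the orbit in between is a congruence [R] containing [E]. It is proper, since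
    the orbit of [w] meets two classes, so maximality forces every nontrivial interval to meet the
    orbit. *)
Lemma orbit_dense a b w : ltE a b -> C w ->
  exists2 g : aut, supp C g & ltE a (g w) /\ ltE (g w) b.
Proof.
move=> ab Cw.
pose O z := exists2 g : aut, supp C g & E z (g w).
have OE x y : E x y -> O x -> O y.
  move=> xy [g gC xg]; exists g => //.
  exact: (cc_trans cE (cc_sym cE xy)).
have Oinv (h : aut) x : supp C h -> O x -> O (h x).
  by move=> hC [g gC xg]; exists (h * g)%g; [exact: suppM|exact: (cc_inv cE hC xg)].
pose R x y := [/\ C x, C y & E x y \/ forall z, between x z y -> ~ O z].
have cR : convex_congruence C R.
  split.
  - by move=> x y [].
  - by move=> x Cx; split=> //; left; exact: (cc_refl cE).
  - move=> x y [Cx Cy xy]; split=> //; case: xy => [/(cc_sym cE)|xy]; first by left.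
    by right=> z /between_sym; exact: xy.
  - move=> y x z [Cx Cy xy] [_ Cz yz]; split=> //.
    case: xy => xy; case: yz => yz.
    + by left; exact: (cc_trans cE xy yz).
    + right=> u /(between_split y)[uB|/yz//] Ou; apply: (yz y).
        exact: between_left.
      apply: OE Ou; apply: (cc_trans cE (cc_sym cE (between_E xy uB)) xy).
    + right=> u /(between_split y)[/xy//|uB] Ou; apply: (xy y).
        exact: between_right.
      by apply: OE Ou; exact: (cc_sym cE (between_E yz uB)).
    + by right=> u /(between_split y)[/xy|/yz].
  - move=> x y z [Cx Cz xz] xy yz; split=> //; first exact: cvC Cx Cz xy yz.
    case: xz => xz; first by left; exact: (cc_convex cE) xz xy yz.
    right=> u uB; apply: xz; exact: between_subinterval xy yz uB.
  - move=> g x y gC [Cx Cy xy]; split; try exact: supp_in.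
    case: xy => xy; first by left; exact: (cc_inv cE).
    by right=> z /between_autV/xy nO /(Oinv _ _ (suppV gC)).
have pR : proper_rel C R.
  have [g gC wg] := orbit_cofinal Cw Cw; exists w, (g w).
  have [_ Cg ltwg nE] := wg; split=> // -[_ _ [//|/(_ w)]]; apply.
    by left; rewrite lexx ltW.
  by exists 1%g => //; exact: (cc_refl cE).
have RE := E_max cR pR.
(* Closed intervals are controlled by [R]; shrinking to [a'], [b'] makes both final inequalities
   strict modulo [E]. *)
have [a' aa' a'b] := quotient_dense ab; have [b' ab' b'b] := quotient_dense a'b.
have [Ca' Cb' lt_ab' nE] := ab'.
have [z [zB [g gC zg]]] : exists z, between a' z b' /\ O z.
  apply: contrapT => nz; apply: nE; apply: RE => [x y xy|].
    by have [Cx Cy] := cc_in cE xy; split=> //; left.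
  by split=> //; right=> z zB Oz; apply: nz; exists z.
have Cz := (cc_in cE zg).1.
have /andP[a'z zb'] : (a' <= z <= b')%O.
  case: zB => // /andP[u v]; have := le_trans u v.
  by rewrite leNgt lt_ab'.
exists g => //; split.
  by apply: (ltE_r cE zg); exact: (ltE_le cE Cz aa' a'z).
by apply: (ltE_l cE zg); exact: (le_ltE cE Cz zb' b'b).
Qed.

End MaximalCongruence.
End PairHomogeneous.

(** * Homogeneity and Ramsey property *)

Lemma sub_count_lt (T : eqType) (a b : pred T) s x : subpred a b ->
  x \in s -> ~~ a x -> b x -> count a s < count b s.
Proof.
move=> ab xs nax bx; elim: s xs => // y s IHs; rewrite inE => /predU1P[<-|xs] /=.
  by rewrite (negbTE nax) bx add0n add1n ltnS sub_count.
rewrite -addnS leq_add ?IHs //.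
by case: (boolP (a y)) => // /ab ->.
Qed.

Lemma sorted_ltn_subseq (s t : seq nat) : sorted ltn s -> sorted ltn t ->
  {subset s <= t} -> subseq s t.
Proof.
move=> ss st sub; suff -> : s = [seq x <- t | x \in s] by exact: filter_subseq.
apply: (irr_sorted_eq ltn_trans ltnn) => //.
  by apply: sorted_filter => //; exact: ltn_trans.
by move=> x; rewrite mem_filter; case: (boolP (x \in s)) => // /sub.
Qed.

Lemma subseq_rcons_case (T : eqType) (s t : seq T) k : subseq s (rcons t k) ->
  subseq s t \/ exists2 s', s = rcons s' k & subseq s' t.
Proof.
case/lastP: s => [|s z]; first by left; exact: sub0seq.
rewrite -subseq_rev !rev_rcons /=; case: eqP => [->|_].
  by rewrite subseq_rev => st; right; exists s.
by rewrite -rev_rcons subseq_rev; left.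
Qed.

(** Elements are added one by one, keeping all iterated ultrafilter limits over subsequences equal
    to the limit at the empty sequence. *)
Lemma finite_ramsey (T : finType) (c : seq nat -> T) n m :
  exists (ks : seq nat) (t : T), [/\ size ks = m, sorted ltn ks &
    forall s, sorted ltn s -> {subset s <= ks} -> size s = n -> c s = t].
Proof.
have [U Uu Uge] := nat_ultrafilter.
have [lim limP] := @choice _ _ (fun (f : nat -> T) t => U [set i | f i = t]%classic)
  (fun f => ultra_lim f).
(* chi e s is the iterated limit of c over e further elements *)
pose chi := fix chi e (s : seq nat) : T :=
  if e is e'.+1 then lim (fun k => chi e' (rcons s k)) else c s.
suff [ks [sz_ks s_ks ksP]] : exists ks, [/\ size ks = m, sorted ltn ks &
    forall s e, subseq s ks -> size s + e = n -> chi e s = chi n [::]].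
  exists ks, (chi n [::]); split=> // s ss sub sz.
  by apply: (ksP s 0); rewrite ?addn0 //; exact: sorted_ltn_subseq.
elim: m => [|m [ks [sz_ks s_ks ksP]]].
  by exists [::]; split=> // s e; rewrite subseq0 => /eqP -> /= <-.
(* Subsequences are indexed by Boolean masks, so that finitely many conditions are imposed and their
   conjunction still lies in [U]. *)
have Uk : U [set k | forall b : (size ks).-tuple bool,
    forall e : 'I_n, size (mask b ks) + e.+1 = n ->
    chi e (rcons (mask b ks) k) = chi n [::]]%classic.
  apply: ultra_forall => b; apply: ultra_forall => e.
  case: (pselect (size (mask b ks) + e.+1 = n)) => [sz|nsz]; last first.
    by apply: filterS filterT => k _ /nsz.
  apply: filterS (limP (fun k => chi e (rcons (mask b ks) k))) => k /= -> _.
  by apply: (ksP (mask b ks) e.+1) => //; exact: mask_subseq.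
have [k [kP k_gt]] := ultra_ex (filterI Uk (Uge (\max_(x <- ks) x).+1)).
exists (rcons ks k); split; first by rewrite size_rcons sz_ks.
  have ks_k : all (ltn^~ k) ks.
    apply/allP => x xks; apply: leq_trans k_gt; rewrite ltnS.
    by rewrite (bigD1_seq x) ?leq_maxl //=; exact: (sorted_uniq ltn_trans ltnn).
  by rewrite (sorted_pairwise ltn_trans) pairwise_rcons ks_k
    -(sorted_pairwise ltn_trans).
move=> s e /subseq_rcons_case[/ksP|[s' -> /subseqP[b sz_b ->]]]; first exact.
move: sz_b => /eqP sz_b; rewrite size_rcons addSnnS => sz.
have en : e < n by rewrite -sz leq_addl.
exact: (kP (Tuple sz_b) (Ordinal en) sz).
Qed.

Lemma seq_max d (L : orderType d) (s : seq L) : s != [::] ->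
  exists2 m, m \in s & forall y, y \in s -> (y <= m)%O.
Proof.
elim: s => // x [|y s] IHs _.
  by exists x; [rewrite inE|move=> z; rewrite inE => /eqP->].
have [//|m ms mP] := IHs; case: (leP x m) => [xm|/ltW mx].
  exists m; first by rewrite inE ms orbT.
  by move=> z; rewrite inE => /predU1P[->//|/mP].
exists x; first by rewrite inE eqxx.
by move=> z; rewrite inE => /predU1P[->//|/mP zm]; exact: le_trans zm mx.
Qed.

Lemma seq_min d (L : orderType d) (s : seq L) : s != [::] ->
  exists2 m, m \in s & forall y, y \in s -> (m <= y)%O.
Proof. exact: (@seq_max _ (L^d)%O). Qed.

(** * Homogeneity and Ramsey property of the coloured quotient *)

Section DenseOrbits.
Context {d : Order.disp_t} {L : orderType d}.
Notation aut := (order_aut L).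
Variables (C : set L) (E : L -> L -> Prop).
Hypotheses (L_countable : countable [set: L]) (cvC : convex C).
Hypothesis cE : convex_congruence C E.
Notation ltE := (ltE C E).
Hypothesis orbit_up : forall z w, C z -> C w ->
  exists2 g : aut, supp C g & ltE z (g w).
Hypothesis orbit_down : forall z w, C z -> C w ->
  exists2 g : aut, supp C g & ltE (g w) z.
Hypothesis orbit_mid : forall a b w, ltE a b -> C w ->
  exists2 g : aut, supp C g & ltE a (g w) /\ ltE (g w) b.

Lemma orbit_insert (lo hi : seq L) x : C x ->
  (forall l, l \in lo -> C l) -> (forall h, h \in hi -> C h) ->
  (forall l h, l \in lo -> h \in hi -> ltE l h) ->
  exists2 g : aut, supp C g &
    (forall l, l \in lo -> ltE l (g x)) /\ (forall h, h \in hi -> ltE (g x) h).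
Proof.
move=> Cx Clo Chi lohi.
have [lo0|/seq_max[l llo lP]] := eqVneq lo [::];
    have [hi0|/seq_min[h hhi hP]] := eqVneq hi [::].
- by rewrite lo0 hi0; exists 1%g.
- rewrite lo0; have [g gC gh] := orbit_down (Chi h hhi) Cx.
  exists g => //; split=> // z zhi.
  by apply: (ltE_le cE) gh (hP _ zhi); exact: Chi.
- rewrite hi0; have [g gC lg] := orbit_up (Clo l llo) Cx.
  exists g => //; split=> // z zlo.
  by apply: (le_ltE cE) (lP _ zlo) lg; exact: Clo.
have [g gC [lg gh]] := orbit_mid (lohi _ _ llo hhi) Cx.
exists g => //; split=> z zs.
  by apply: (le_ltE cE) (lP _ zs) lg; exact: Clo.
by apply: (ltE_le cE) gh (hP _ zs); exact: Chi.
Qed.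

(** On one class the map is induced by a single element of G_C, while different classes are linked
    only by their order: a finite partial automorphism of the coloured order C/E with chosen
    lifts. *)
Definition partial_aut (s : seq (L * L)) :=
  [/\ forall p, p \in s -> ~ C p.1 -> p.2 = p.1,
      forall p, p \in s -> C p.1 -> exists2 g : aut, supp C g &
        forall q, q \in s -> E p.1 q.1 -> g q.1 = q.2 &
      forall p q, p \in s -> q \in s -> ltE p.1 q.1 -> ltE p.2 q.2].

Lemma partial_aut_in s p : partial_aut s -> p \in s -> C p.1 <-> C p.2.
Proof.
move=> [fix_out loc _] ps; split=> [Cp|Cp2].
  have [g gC gE] := loc _ ps Cp.
  by rewrite -(gE p ps (cc_refl cE Cp)); exact: supp_in.
by apply: contrapT => nC; rewrite (fix_out _ ps nC) in Cp2.
Qed.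

Lemma partial_aut_E s p q : partial_aut s -> p \in s -> q \in s ->
  E p.1 q.1 -> E p.2 q.2.
Proof.
move=> [_ loc _] ps qs pq; have [Cp _] := cc_in cE pq.
have [g gC gE] := loc _ ps Cp.
by rewrite -(gE p ps (cc_refl cE Cp)) -(gE q qs pq); exact: (cc_inv cE).
Qed.

Lemma partial_aut_sym s :
  partial_aut s -> partial_aut [seq (p.2, p.1) | p <- s].
Proof.
move=> ps; have [fix_out loc mono] := ps.
have Erefl p q : p \in s -> q \in s -> E p.2 q.2 -> E p.1 q.1.
  move=> pin qin pq; have [Cp Cq] := cc_in cE pq.
  have Cp1 := (partial_aut_in ps pin).2 Cp.
  have Cq1 := (partial_aut_in ps qin).2 Cq.
  case: (ltE_or cE Cp1 Cq1) => [//|/(mono _ _ pin qin)|/(mono _ _ qin pin)].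
    by move/ltE_irr; case.
  by move/ltE_irr; case; exact: (cc_sym cE).
split=> [_ /mapP[p pin ->]|_ /mapP[p pin ->]|].
- by move=> /= nC; apply/esym/fix_out => // /(partial_aut_in ps pin).
- move=> /= /(partial_aut_in ps pin) Cp; have [g gC gE] := loc _ pin Cp.
  exists (g^-1)%g; first exact: suppV.
  move=> _ /mapP[q qin ->] /= /(Erefl _ _ pin qin) pq.
  by rewrite -(gE q qin pq); exact: autK.
- move=> _ _ /mapP[p pin ->] /mapP[q qin ->] /= pq; have [Cp Cq _ _] := pq.
  have Cp1 := (partial_aut_in ps pin).2 Cp.
  have Cq1 := (partial_aut_in ps qin).2 Cq.
  case: (ltE_or cE Cp1 Cq1) => [/(partial_aut_E ps pin qin) e|//|].
    by case: (ltE_irr pq e).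
  by move=> /(mono _ _ qin pin)/(ltE_asym pq).
Qed.

(** A point of a class already met follows the lift chosen there. A new class is sent, by density of
    its orbit, into the gap prescribed by the classes below and above it. *)
Lemma partial_aut_forth s x :
  partial_aut s -> exists y, partial_aut ((x, y) :: s).
Proof.
move=> ps; have [fix_out loc mono] := ps.
case: (pselect (C x)) => [Cx|nCx]; last first.
  exists x; split=> [p|p|p q].
  - by rewrite inE => /predU1P[->//|]; exact: fix_out.
  - rewrite inE => /predU1P[->//|pin Cp]; have [g gC gE] := loc _ pin Cp.
    exists g => // q; rewrite inE => /predU1P[->|]; last exact: gE.
    by move=> /(cc_in cE)[].
  - rewrite !inE => /predU1P[->|pin] /predU1P[->|qin]; try by case.
    exact: mono.
case: (pselect (exists2 p, p \in s & E p.1 x)) => [[p pin px]|np].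
  have [Cp _] := cc_in cE px; have [g gC gE] := loc _ pin Cp.
  have p2 : g p.1 = p.2 by apply: gE => //; exact: (cc_refl cE).
  have gx : E p.2 (g x) by rewrite -p2; exact: (cc_inv cE).
  exists (g x); split=> [q|q|q r].
  - by rewrite inE => /predU1P[->//|]; exact: fix_out.
  - move=> qin Cq; case: (pselect (E p.1 q.1)) => pq.
      exists g => // r; rewrite inE => /predU1P[->//|rin] qr; apply: gE => //.
      exact: (cc_trans cE pq).
    move: qin; rewrite inE => /predU1P[qx|qin]; first by rewrite qx in pq.
    have [h hC hE] := loc _ qin Cq; exists h => // r.
    rewrite inE => /predU1P[->|]; last exact: hE.
    by move=> /= qx; case: pq; exact: (cc_trans cE px (cc_sym cE qx)).
  - rewrite !inE => /predU1P[->|qin] /predU1P[->|rin] /=.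
    + by move/ltE_irr; case; exact: (cc_refl cE).
    + move=> /(ltE_l cE (cc_sym cE px))/(mono _ _ pin rin).
      exact: (ltE_l cE gx).
    + move=> /(ltE_r cE (cc_sym cE px))/(mono _ _ qin pin).
      exact: (ltE_r cE gx).
    + exact: mono.
pose lo := [seq p.2 | p <- s & `[< ltE p.1 x >]].
pose hi := [seq p.2 | p <- s & `[< ltE x p.1 >]].
have [||||g gC [glo ghi]] := @orbit_insert lo hi x.
- exact: Cx.
- move=> l /mapP[p]; rewrite mem_filter => /andP[/asboolP[Cp _ _ _] pin] ->.
  exact/(partial_aut_in ps pin).
- move=> l /mapP[p]; rewrite mem_filter => /andP[/asboolP[_ Cp _ _] pin] ->.
  exact/(partial_aut_in ps pin).
- move=> l h /mapP[p]; rewrite mem_filter => /andP[/asboolP px pin] ->.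
  move=> /mapP[q]; rewrite mem_filter => /andP[/asboolP xq qin] ->.
  by apply: mono => //; exact: (ltE_trans cE) px xq.
exists (g x); split=> [q|q|q r].
- by rewrite inE => /predU1P[->//|]; exact: fix_out.
- rewrite inE => /predU1P[->|qin] Cq.
    exists g => // r; rewrite inE => /predU1P[->//|rin] /= xr.
    by case: np; exists r => //; exact: (cc_sym cE).
  have [h hC hE] := loc _ qin Cq; exists h => // r.
  rewrite inE => /predU1P[->|]; last exact: hE.
  by move=> /= qx; case: np; exists q.
- rewrite !inE => /predU1P[->|qin] /predU1P[->|rin] /=.
  + by move/ltE_irr; case; exact: (cc_refl cE).
  + move=> xr; apply: ghi; apply/mapP; exists r => //.
    by rewrite mem_filter rin andbT; apply/asboolP.
  + move=> qx; apply: glo; apply/mapP; exists q => //.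
    by rewrite mem_filter qin andbT; apply/asboolP.
  + exact: mono.
Qed.

Lemma partial_aut_back s y :
  partial_aut s -> exists x, partial_aut ((x, y) :: s).
Proof.
move=> /partial_aut_sym/(partial_aut_forth y)[x /partial_aut_sym].
rewrite /= -map_comp /= => ps; exists x.
by rewrite (_ : map _ s = s) in ps => //; apply: map_id_in => -[].
Qed.

Lemma partial_aut_mono s p q : partial_aut s -> p \in s -> q \in s ->
  (p.1 <= q.1)%O = (p.2 <= q.2)%O.
Proof.
move=> ps pin qin; have [fix_out loc mono] := ps.
have Cin r : r \in s -> C r.1 -> C r.2 by move=> rin /(partial_aut_in ps rin).
case: (pselect (C p.1)) => Cp; case: (pselect (C q.1)) => Cq.
- have := ltE_or cE Cp Cq; case=> [pq|pq|qp].
  + have [g gC gE] := loc _ pin Cp.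
    by rewrite -(gE p pin (cc_refl cE Cp)) -(gE q qin pq) aut_mono.
  + have [_ _ /ltW -> _] := pq.
    by have [_ _ /ltW -> _] := mono _ _ pin qin pq.
  + have [_ _ + _] := qp; have [_ _ + _] := mono _ _ qin pin qp.
    by rewrite !ltNge => /negbTE-> /negbTE->.
- rewrite (fix_out q) //; have Cp2 := Cin _ pin Cp.
  apply/idP/idP => h; case: leP => // /ltW h'; case: Cq.
    exact: cvC Cp Cp2 h h'.
  exact: cvC Cp2 Cp h h'.
- rewrite (fix_out p) //; have Cq2 := Cin _ qin Cq.
  apply/idP/idP => h; case: leP => // /ltW h'; case: Cp.
    exact: cvC Cq2 Cq h' h.
  exact: cvC Cq Cq2 h' h.
- by rewrite (fix_out p) // (fix_out q).
Qed.

Lemma class_homogeneous (s : seq (L * L)) :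
  (forall p, p \in s -> C p.1 /\ exists2 g : aut, supp C g & g p.1 = p.2) ->
  (forall p q, p \in s -> q \in s ->
    [\/ p = q, ltE p.1 q.1 /\ ltE p.2 q.2 | ltE q.1 p.1 /\ ltE q.2 p.2]) ->
  exists2 g : aut, supp C g & forall p, p \in s -> g p.1 = p.2.
Proof.
move=> sC s_mono; have [|s' x|s' y|s' p q|g [gs gP]] :=
  @back_and_forth _ L partial_aut s L_countable.
- split=> [p /sC[]//|p ps Cp|p q ps qs pq].
    have [_ [g gC gp]] := sC _ ps; exists g => // q qs pq.
    case: (s_mono _ _ ps qs) => [<-//|[/ltE_irr + _]|[/ltE_irr + _]]; case=> //.
    exact: (cc_sym cE).
  case: (s_mono _ _ ps qs) => [e|[]//|[/(ltE_asym pq)//]].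
  by case: (ltE_irr pq); rewrite e; apply: (cc_refl cE); case: pq; rewrite e.
- exact: partial_aut_forth.
- exact: partial_aut_back.
- exact: partial_aut_mono.
exists g => // x nCx; have [s' [fix_out _ _] xs'] := gP x.
exact: (fix_out (x, g x)).
Qed.

(** [Y k] sends each point into the [k]-th block, where, up to [E], there is one class for each
    orbit of classes. Only the finite set [Z] has to be bounded above by the next block. *)
Lemma orbit_blocks (Z : seq L) b0 : C b0 -> (forall z, z \in Z -> C z) ->
  exists Y : nat -> L -> L,
  [/\ forall k x, C x -> exists2 g : aut, supp C g & g x = Y k x,
      forall k x x', C x -> C x' ->
        (exists2 g : aut, supp C g & E x' (g x)) -> E (Y k x) (Y k x') &
      forall k k' x x', k < k' -> x \in Z -> x' \in Z -> ltE (Y k x) (Y k' x')].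
Proof.
move=> Cb0 ZC.
pose orb x := [set y | exists2 g : aut, supp C g & E y (g x)]%classic.
pose col x := xget b0 (orb x).
have colP x : C x -> orb x (col x).
  by move=> Cx; apply: (@xgetI _ _ _ x); exists 1%g => //; exact: (cc_refl cE).
have col_eq x y : (exists2 g : aut, supp C g & E y (g x)) -> col x = col y.
  move=> [g gC yg]; congr xget; apply/seteqP; split=> z [h hC zh].
    exists (h * g^-1)%g; first exact: suppM (suppV gC).
    apply: (cc_trans cE zh); apply: (cc_inv cE hC).
    by have /(cc_sym cE) := cc_inv cE (suppV gC) yg; rewrite autK.
  exists (h * g)%g; first exact: suppM.
  exact: (cc_trans cE zh (cc_inv cE hC yg)).
pose block (b : L) (y : L -> L) :=
  [/\ forall x, C x -> exists2 g : aut, supp C g & g x = y x,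
      forall x x', C x -> C x' -> col x = col x' -> E (y x) (y x') &
      forall x, C x -> ltE b (y x)].
have block_ex b : C b -> exists y, block b y.
  move=> Cb; have /choice[rho rhoP] z : exists r, C z ->
      exists2 g : aut, supp C g & g z = r /\ ltE b r.
    case: (pselect (C z)) => [Cz|nCz]; last by exists z.
    by have [g gC bg] := orbit_up Cb Cz; exists (g z) => _; exists g.
  have /choice[y yP] x : exists y, C x ->
      (exists2 g : aut, supp C g & g x = y) /\ E (rho (col x)) y.
    case: (pselect (C x)) => [Cx|nCx]; last by exists x.
    have [g gC cg] := colP x Cx; have [Cc _] := cc_in cE cg.
    have [h hC [hc _]] := rhoP _ Cc; exists (h (g x)) => _; split.
      by exists (h * g)%g; first exact: suppM.
    by rewrite -hc; exact: (cc_inv cE).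
  exists y; split=> [x /yP[]//|x x' Cx Cx' xx'|x Cx].
    have [_ e] := yP x Cx; have [_ e'] := yP x' Cx'.
    by rewrite xx' in e; exact: (cc_trans cE (cc_sym cE e) e').
  have [_ e] := yP x Cx; have [g gC cg] := colP x Cx.
  have [Cc _] := cc_in cE cg; have [_ _ [_ br]] := rhoP _ Cc.
  exact: (ltE_r cE e br).
(* The state carries a bound in [C] for the images of [Z] in all blocks built so far. *)
pose R (n : nat) (p q : {b | C b} * (L -> L)) := [/\ block (sval p.1) q.2,
  (sval p.1 <= sval q.1)%O & forall x, x \in Z -> (q.2 x <= sval q.1)%O].
have Rt n p : exists q, R n p q.
  have [y yP] := block_ex _ (svalP p.1); have [y1 _ _] := yP.
  have [//|m] := @seq_max _ L (sval p.1 :: [seq y x | x <- Z]).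
  rewrite inE => m_in mP.
  have Cm : C m.
    case/predU1P: m_in => [->|/mapP[x xZ ->]]; first exact: svalP.
    by have [g gC <-] := y1 _ (ZC _ xZ); apply: supp_in gC _; exact: ZC.
  exists (exist C m Cm, y); split=> //=; first by apply: mP; rewrite inE eqxx.
  by move=> x xZ; apply: mP; rewrite inE map_f ?orbT.
have [f [_ fR]] := nat_dependent_choice (exist C b0 Cb0, id) Rt.
exists (fun k => (f k.+1).2); split.
- by move=> k; have [[]] := fR k.
- by move=> k x x' Cx Cx' /col_eq xx'; have [[_ H _] _ _] := fR k; exact: H.
- move=> k k' x x' kk' xZ x'Z; have [[_ _ bl] _ _] := fR k'.
  have [[y1 _ _] _ le_b] := fR k.
  have Cy : C ((f k.+1).2 x).
    by have [g gC <-] := y1 _ (ZC _ xZ); apply: supp_in gC _; exact: ZC.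
  apply: (le_ltE cE Cy _ (bl _ (ZC _ x'Z))).
  apply: le_trans (le_b _ xZ) _; elim: k' kk' {bl} => // k' IHk'.
  rewrite ltnS leq_eqVlt => /predU1P[->//|/IHk' h].
  by have [_ h' _] := fR k'; exact: le_trans h h'.
Qed.

(** Send all translates of [u] by [F] into blocks with numbers in one homogeneous set, in increasing
    order of classes. Each [(g * f)] then places [u] along an increasing sequence of homogeneous
    block numbers, so all receive the same colour. *)
Lemma structural_ramsey (T : finType) (chi : aut -> T) (x0 : L) (u : seq L)
    (F : seq aut) :
  C x0 -> (forall x, x \in u -> C x) -> pairwise (fun x y => `[< ltE x y >]) u ->
  (forall g g' : aut, supp C g -> supp C g' ->
    (forall x, x \in u -> E (g x) (g' x)) -> chi g = chi g') ->
  (forall f, f \in F -> supp C f) ->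
  exists2 g, supp C g & forall f, f \in F -> chi (g * f)%g = chi g.
Proof.
move=> Cx0 uC /(pairwiseP x0) u_lt chiE FC.
have u_ltE i j : i < j -> j < size u -> ltE (nth x0 u i) (nth x0 u j).
  by move=> ij ju; apply/asboolP/u_lt => //; rewrite inE; exact: ltn_trans ju.
have nuC i : i < size u -> C (nth x0 u i) by move=> iu; apply: uC; exact: mem_nth.
(* The identity is added so that [g] itself gets the common colour. *)
pose F1 : seq aut := 1%g :: F.
have F1C f : f \in F1 -> supp C f by rewrite inE => /predU1P[->|/FC].
pose Z := [seq aut_fun f x | f <- F1, x <- u].
have ZC z : z \in Z -> C z.
  by move=> /allpairsP[[f x] /= [fF xu ->]]; apply: supp_in (F1C _ fF) (uC _ xu).
have [Y [Y_orb Y_col Y_lt]] := orbit_blocks Cx0 ZC.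
have YC k x : C x -> C (Y k x).
  by move=> Cx; have [g gC <-] := Y_orb k x Cx; exact: supp_in.
have uZ x : x \in u -> x \in Z.
  by move=> xu; apply/allpairsP; exists (1%g, x); rewrite inE eqxx.
have /choice[gs gsP] (s : seq nat) : exists g : aut, supp C g /\
    (size s = size u -> sorted ltn s -> forall i, i < size u ->
      g (nth x0 u i) = Y (nth 0 s i) (nth x0 u i)).
  case: (pselect (size s = size u /\ sorted ltn s)) => [[sz ss]|ns]; last first.
    by exists 1%g; split=> // sz ss; case: ns.
  move: ss; rewrite (sorted_pairwise ltn_trans) => /(pairwiseP 0) s_lt.
  have lt_pair i j : i < j -> j < size u -> ltE (nth x0 u i) (nth x0 u j) /\
      ltE (Y (nth 0 s i) (nth x0 u i)) (Y (nth 0 s j) (nth x0 u j)).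
    move=> ij ju; have iu := ltn_trans ij ju; split; first exact: u_ltE.
    apply: Y_lt; rewrite ?uZ ?mem_nth //.
    by apply: s_lt; rewrite ?inE ?sz.
  have [||g gC gE] := @class_homogeneous
      [seq (nth x0 u i, Y (nth 0 s i) (nth x0 u i)) | i <- iota 0 (size u)].
  - move=> p /mapP[i]; rewrite mem_iota add0n /= => iu -> /=.
    by split; [exact: nuC|apply: Y_orb; exact: nuC].
  - move=> p q /mapP[i]; rewrite mem_iota add0n /= => iu ->.
    move=> /mapP[j]; rewrite mem_iota add0n /= => ju -> /=.
    case: (ltngtP i j) => [ij|ji|->]; last by constructor 1.
      by constructor 2; exact: lt_pair.
    by constructor 3; exact: lt_pair.
  exists g; split=> // _ _ i iu.
  apply: (gE (nth x0 u i, _)); apply/mapP; exists i => //.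
  by rewrite mem_iota.
(* Ranks in [Z] run up to [size Z], so one more index makes every rank a valid position in [ks]. *)
have [ks [t [sz_ks s_ks ksP]]] := finite_ramsey (chi \o gs) (size u) (size Z).+1.
pose rk z := count (fun y => `[< ltE y z >]) Z.
have rk_E z z' : E z z' -> rk z = rk z'.
  move=> zz'; apply: eq_count => y /=; apply/asboolP/asboolP.
    exact: (ltE_r cE zz').
  exact: (ltE_r cE (cc_sym cE zz')).
have rk_lt z z' : z \in Z -> ltE z z' -> rk z < rk z'.
  move=> zZ zz'; rewrite /rk.
  have sub y : `[< ltE y z >] -> `[< ltE y z' >].
    by move=> /asboolP yz; apply/asboolP; exact: (ltE_trans cE) yz zz'.
  apply: (sub_count_lt sub zZ); last exact/asboolP.
  by apply/asboolP => -[_ _]; rewrite ltxx.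
have rk_ks z : rk z < size ks by rewrite sz_ks ltnS count_size.
have ks_lt i j : i < j -> j < size ks -> nth 0 ks i < nth 0 ks j.
  move=> ij jks; have := s_ks; rewrite (sorted_pairwise ltn_trans).
  by move=> /(pairwiseP 0); apply; rewrite ?inE //; exact: ltn_trans jks.
(* Representatives make the prescribed pairs coincide for points of [Z] in one class, as
   [class_homogeneous] demands. *)
have [cl [clP cl_eq]] := class_repr cE x0.
have Y_cl k z : C z -> E (Y k (cl z)) (Y k z).
  move=> Cz; have [_ Ccl] := cc_in cE (clP z Cz).
  by apply: Y_col => //; exists 1%g => //; exact: clP.
pose K z := nth 0 ks (rk z).
have cl_lt z z' : z \in Z -> z' \in Z -> ltE z z' ->
    ltE (cl z) (cl z') /\ ltE (Y (K z) (cl z)) (Y (K z') (cl z')).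
  move=> zZ z'Z zz'; have [Cz Cz' _ _] := zz'; split.
    by apply: (ltE_l cE (clP z Cz)); exact: (ltE_r cE (clP z' Cz')).
  apply: (ltE_l cE (cc_sym cE (Y_cl _ _ Cz))).
  apply: (ltE_r cE (cc_sym cE (Y_cl _ _ Cz'))).
  by apply: Y_lt => //; apply: ks_lt => //; exact: rk_lt.
have [||g gC gE] := @class_homogeneous [seq (cl z, Y (K z) (cl z)) | z <- Z].
- move=> p /mapP[z /ZC Cz ->] /=; have [_ Ccl] := cc_in cE (clP z Cz).
  by split=> //; exact: Y_orb.
- move=> p q /mapP[z zZ ->] /mapP[z' z'Z ->] /=.
  case: (ltE_or cE (ZC _ zZ) (ZC _ z'Z)) => [zz'|zz'|zz'].
  + by constructor 1; rewrite /K (cl_eq _ _ zz') (rk_E _ _ zz').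
  + by constructor 2; exact: cl_lt.
  + by constructor 3; exact: cl_lt.
exists g => //; suff chi_t f : f \in F1 -> chi (g * f)%g = t.
  move=> f fF; rewrite chi_t ?inE ?fF ?orbT // -[g in RHS]mulg1.
  by rewrite chi_t // inE eqxx.
move=> fF; have fC := F1C _ fF.
pose s := [seq K (f x) | x <- u].
have fZ x : x \in u -> f x \in Z by move=> xu; apply/allpairsP; exists (f, x).
have s_sorted : sorted ltn s.
  rewrite (sorted_pairwise ltn_trans); apply/(pairwiseP 0) => i j.
  rewrite !inE !size_map => iu ju ij; rewrite !(nth_map x0) //.
  apply: ks_lt => //; apply: rk_lt; first by apply: fZ; exact: mem_nth.
  exact: (ltE_aut cE fC (u_ltE _ _ ij ju)).
have <- : (chi \o gs) s = t.
  apply: ksP => //; rewrite ?size_map //.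
  by move=> k /mapP[x _ ->]; exact: mem_nth.
apply: chiE; [exact: suppM|exact: (gsP s).1|move=> x xu].
have ix : index x u < size u by rewrite index_mem.
have := (gsP s).2 (size_map _ _) s_sorted _ ix.
rewrite nth_index // (nth_map x0) // nth_index // => ->; rewrite autME.
have Cfx := supp_in fC (uC _ xu).
have gcl : g (cl (f x)) = Y (K (f x)) (cl (f x)).
  by apply: (gE (cl (f x), _)); apply/mapP; exists (f x) => //; exact: fZ.
apply: (cc_trans cE (cc_inv cE gC (clP _ Cfx))); rewrite gcl.
apply: (cc_trans cE (Y_cl _ _ Cfx)); apply: (cc_sym cE).
apply: Y_col; [exact: uC|exact: Cfx|exists f => //].
exact: (cc_refl cE).
Qed.

End DenseOrbits.

(** * Fixed points *)

Section AutNeighbourhoods.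
Context {d : Order.disp_t} {L : orderType d}.
Local Open Scope classical_set_scope.

Lemma nbhs_aut1 (V : set (order_aut L)) : nbhs (1%g : order_aut L) V ->
  exists a : seq L, forall g : order_aut L, (forall x, x \in a -> g x = x) -> V g.
Proof.
pose B (a : seq L) := [set g : order_aut L | forall x, x \in a -> g x = x].
pose F := filter_from [set: seq L] B.
have FF : Filter F.
  apply: filter_from_filter; first by exists [::].
  move=> a b _ _; exists (a ++ b) => // g gab.
  by split=> x xs; apply: gab; rewrite mem_cat xs ?orbT.
have cF : aut_ptws @ F --> aut_ptws (1%g : order_aut L).
  apply/cvg_sup => x A [B' [[W oW <-]] /= Wx] sub.
  exists [:: x] => // g gx; apply: sub.
  have gxx : g x = x by apply: gx; rewrite inE.
  by rewrite /= /aut_ptws gxx.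
move=> [V' [[W oW <-]] /= W1 WV].
have [a _ aW] : (aut_ptws @ F) W by apply: cF; exact: open_nbhs_nbhs.
by exists a => g ga; apply: WV; exact: aW.
Qed.

End AutNeighbourhoods.

Section CompactFip.
Local Open Scope classical_set_scope.

Lemma compact_fip (X : topologicalType) (Y : set X) (I : eqType)
    (Q : I -> set X) :
  compact Y -> (forall i, closed (Q i)) ->
  (forall s : seq I, exists2 y, Y y & forall i, i \in s -> Q i y) ->
  exists2 y, Y y & forall i, Q i y.
Proof.
move=> cY cQ fip.
pose B (s : seq I) := [set y | Y y /\ forall i, i \in s -> Q i y].
pose F := filter_from [set: seq I] B.
have FF : ProperFilter F.
  apply: filter_from_proper => [|s _]; last first.
    by have [y Yy ys] := fip s; exists y.
  apply: filter_from_filter; first by exists [::].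
  move=> s t _ _; exists (s ++ t) => // y [Yy yst].
  by split; split=> // i ist; apply: yst; rewrite mem_cat ist ?orbT.
have [|y [Yy yF]] := cY F FF; first by exists [::] => // y [].
exists y => // i; apply: (cQ i) => A Ay.
have [|z [[_ zi] Az]] := yF (B [:: i]) A _ Ay; first by exists [:: i].
by exists z; split=> //; apply: zi; rewrite inE.
Qed.

End CompactFip.

Section Flow.
Context {d : Order.disp_t} {L : orderType d}.
Notation aut := (order_aut L).
Variables (X : topologicalType) (act : aut -> X -> X).
Hypotheses (cX : compact [set: X]%classic) (hX : hausdorff_space X).
Hypothesis act_cont : continuous_action act.
Local Open Scope classical_set_scope.

Lemma act1 x : act 1%g x = x. Proof. by have [H _ _] := act_cont; exact: H. Qed.

Lemma actM g h x : act (g * h)%g x = act g (act h x).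
Proof. by have [_ H _] := act_cont; exact: H. Qed.

Lemma actVK g x : act g (act g^-1%g x) = x.
Proof. by rewrite -actM mulgV act1. Qed.

Lemma act_nbhs (g : aut) x (W : set X) : nbhs (act g x) W ->
  exists (V : set aut) (O : set X), [/\ nbhs g V, nbhs x O &
    forall h y, V h -> O y -> W (act h y)].
Proof.
have [_ _ H] := act_cont; move=> /(H (g, x))[[V O] /= [gV xO] sub].
by exists V, O; split=> // h y Vh Oy; exact: (sub (h, y)).
Qed.

Lemma act_nbhs_pt (g : aut) x (W : set X) : nbhs (act g x) W ->
  nbhs x [set y | W (act g y)].
Proof.
move=> /act_nbhs[V [O [gV xO sub]]]; apply: filterS xO => y Oy.
by apply: sub => //; exact: nbhs_singleton.
Qed.

Definition fixed_by (D : set L) := [set y | forall g, supp D g -> act g y = y].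

Lemma closed_fixed_by D : closed (fixed_by D).
Proof.
move=> y cly g gD; apply: hX => A B Ay By.
have [z [zfix [Az Bz]]] := cly _ (filterI (act_nbhs_pt Ay) By).
by exists z; split=> //; rewrite -(zfix g gD).
Qed.

Definition fixpoint_property (C : set L) := forall Y : set X,
  closed Y -> Y !=set0 -> (forall g y, supp C g -> Y y -> Y (act g y)) ->
  exists2 y, Y y & fixed_by C y.

(** * Points fixed by the groups of all classes *)

Section Classes.
Variables (C : set L) (E : L -> L -> Prop) (Y : set X).
Hypotheses (cE : convex_congruence C E).
Hypothesis fpE : forall x, C x -> fixpoint_property (E x).
Hypotheses (clY : closed Y) (Y0 : Y !=set0).
Hypothesis Yinv : forall g y, supp C g -> Y y -> Y (act g y).

Lemma classes_commute x x' (g h : aut) :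
  ~ E x x' -> supp (E x) g -> supp (E x') h -> (g * h = h * g)%g.
Proof.
move=> nE gx hx'; apply: order_autP => z; rewrite !autME.
have disj a : E x a -> E x' a -> False.
  by move=> xa x'a; apply: nE; exact: (cc_trans cE xa (cc_sym cE x'a)).
case: (pselect (E x z)) => [xz|nxz].
  rewrite hx'; last by move/(disj z xz).
  by rewrite hx' // => /(disj _ (supp_in gx xz)).
rewrite (gx z) //; case: (pselect (E x' z)) => [x'z|nx'z]; last first.
  by rewrite (hx' z) // gx.
by rewrite gx // => xh; exact: disj xh (supp_in hx' x'z).
Qed.

(** Groups of distinct classes commute, so each one preserves the closed set of points fixed by the
    others, and its fixed-point property applies there. *)
Lemma finite_classes_fixed (xs : seq L) : (forall x, x \in xs -> C x) ->
  exists2 y, Y y & forall x, x \in xs -> fixed_by (E x) y.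
Proof.
elim: xs => [|x xs IHxs] xsC; first by have [y Yy] := Y0; exists y.
have [y Yy yfix] : exists2 y, Y y & forall x, x \in xs -> fixed_by (E x) y.
  by apply: IHxs => z zxs; apply: xsC; rewrite inE zxs orbT.
have Cx : C x by apply: xsC; rewrite inE eqxx.
have [||g z gx [Yz zfix]|z [Yz zfix] zx] :=
    fpE Cx (Y := [set y | Y y /\ forall x, x \in xs -> fixed_by (E x) y]).
- move=> z clz; split.
    by apply: clY => A /clz[w [[Yw _] Aw]]; exists w.
  move=> x' x'xs; apply: closed_fixed_by => A /clz[w [[_ wfix] Aw]].
  by exists w; split=> //; exact: wfix.
- by exists y.
- split; first by apply: Yinv Yz; exact: supp_subset (class_subset cE (x := x)) gx.
  move=> x' x'xs h hx'; case: (pselect (E x x')) => [xx'|nxx'].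
    have gx' : supp (E x') g.
      by apply: supp_subset gx => w; exact: (cc_trans cE (cc_sym cE xx')).
    by rewrite (zfix x') ?(zfix x').
  rewrite -actM -(classes_commute nxx' gx hx') actM.
  by congr act; exact: (zfix x').
exists z => // x'; rewrite inE => /predU1P[->//|]; exact: zfix.
Qed.

Lemma classes_fixed : exists2 y, Y y & forall x, C x -> fixed_by (E x) y.
Proof.
have [||s|y Yy yfix] := @compact_fip X Y L
    (fun x => [set y | C x -> fixed_by (E x) y]).
- exact: (subclosed_compact clY cX).
- move=> x; case: (pselect (C x)) => [Cx|nCx].
    rewrite (_ : [set y | _] = fixed_by (E x)); first exact: closed_fixed_by.
    by apply/seteqP; split=> y /= h; [exact: h|move=> _].
  rewrite (_ : [set y | _] = setT); first exact: closedT.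
  by apply/seteqP; split=> y // _ /nCx.
- have [|y Yy yfix] := @finite_classes_fixed [seq x <- s | `[< C x >]].
    by move=> x; rewrite mem_filter => /andP[/asboolP].
  exists y => // x xs Cx; apply: yfix; rewrite mem_filter xs andbT.
  exact/asboolP.
by exists y => // x Cx; exact: (yfix x Cx).
Qed.

End Classes.

Lemma cut_fixpoint (C I : set L) :
  convex C -> invariant_cut C I -> ~ C `<=` I ->
  (forall x, C x -> fixpoint_property (fun y => [/\ C x, C y & I x <-> I y])) ->
  fixpoint_property C.
Proof.
move=> cvC cutI nCI fpE Y clY Y0 Yinv; have cE := cut_congruence cvC cutI.
have [y Yy yfix] := classes_fixed cE fpE clY Y0 Yinv.
exists y => // g gC; have [IC _ Iinv [x Ix]] := cutI.
have [x' [Cx' nIx']] : exists x', C x' /\ ~ I x'.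
  apply: contrapT => H; apply: nCI => z Cz; apply: contrapT => nIz.
  by apply: H; exists z.
have Cx := IC _ Ix.
(* [n] agrees with [g] on the lower half, so [(g * n^-1)] is supported on the upper half; [x] and
   [x'] name the two halves. *)
have [|n nx nE] := class_restrict cE (x := x) gC.
  by split; [|exact: supp_in|split=> // _; exact: Iinv].
suff gn : supp (fun z => [/\ C x', C z & I x' <-> I z]) (g * n^-1)%g.
  by rewrite -[g](mulgVK n) actM (yfix x Cx n nx); exact: (yfix x' Cx').
move=> z nz; rewrite autME; case: (pselect (C z)) => [Cz|nCz]; last first.
  by rewrite (suppV nx) ?gC // => -[].
have Iz : I z.
  by apply: contrapT => nIz; apply: nz; split=> //; split=> [/nIx'|/nIz].
have xz : [/\ C x, C z & I x <-> I z] by split.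
by rewrite -nE ?autVK //; exact: (supp_in (suppV nx) xz).
Qed.

(** * Fixed points over a dense quotient *)

Section DenseClasses.
Variables (C : set L) (E : L -> L -> Prop).
Hypotheses (L_countable : countable [set: L]) (cvC : convex C).
Hypotheses (cE : convex_congruence C E) (pE : proper_rel C E).
Hypothesis orbit_up : forall z w, C z -> C w ->
  exists2 g : aut, supp C g & ltE C E z (g w).
Hypothesis orbit_down : forall z w, C z -> C w ->
  exists2 g : aut, supp C g & ltE C E (g w) z.
Hypothesis orbit_mid : forall a b w, ltE C E a b -> C w ->
  exists2 g : aut, supp C g & ltE C E a (g w) /\ ltE C E (g w) b.
Hypothesis fpE : forall x, C x -> fixpoint_property (E x).

Let classes_fix (y : X) := forall x, C x -> fixed_by (E x) y.

Lemma classes_fix_inv g y : supp C g -> classes_fix y -> classes_fix (act g y).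
Proof.
move=> gC yfix x Cx n nx.
have gVx : C (g^-1%g x) by exact: supp_in (suppV gC) Cx.
have -> : act n (act g y) = act g (act (g^-1 * n * g)%g y).
  by rewrite !actM actVK.
congr act; apply: (yfix _ gVx) => z nz; rewrite !autME nx ?autK // => xgz.
by apply: nz; have := cc_inv cE (suppV gC) xgz; rewrite autK.
Qed.

(** Dividing [h] by its restriction to a class does not change its effect on [z]. The last clause
    keeps the action on classes, so that the next class can be absorbed too. *)
Lemma absorb_classes z h (us : seq L) : classes_fix z -> supp C h ->
  (forall x, x \in us -> E x (h x)) ->
  exists v, [/\ supp C v, act v z = act h z,
    forall x y, x \in us -> E x y -> v y = y &
    forall y, C y -> E (h y) (v y)].
Proof.
move=> zfix hC; elim: us => [|x us IHus] usE.
  by exists h; split=> // y Cy; apply: (cc_refl cE); exact: supp_in.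
have [|v [vC vz vus vE]] := IHus.
  by move=> y yus; apply: usE; rewrite inE yus orbT.
have xh : E x (h x) by apply: usE; rewrite inE eqxx.
have [Cx _] := cc_in cE xh.
have xv : E x (v x) by exact: (cc_trans cE xh (vE _ Cx)).
have [n nx nE] := class_restrict cE vC xv.
have nC : supp C n by exact: supp_subset (class_subset cE (x := x)) nx.
have vn_x y : E x y -> (v * n^-1)%g y = y.
  by move=> xy; rewrite autME -nE ?autVK //; exact: (supp_in (suppV nx) xy).
exists (v * n^-1)%g; split.
- exact: suppM (suppV nC).
- by rewrite actM (zfix x Cx _ (suppV nx)).
- move=> x' y; rewrite inE => /predU1P[->|x'us] x'y; first exact: vn_x.
  case: (pselect (E x y)) => [/vn_x//|nxy].
  by rewrite autME (suppV nx) //; exact: vus x'us x'y.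
- move=> y Cy; apply: (cc_trans cE (vE y Cy)); rewrite autME.
  apply: (cc_inv cE vC); case: (pselect (E x y)) => [xy|nxy]; last first.
    by rewrite (suppV nx) //; exact: (cc_refl cE).
  exact: (cc_trans cE (cc_sym cE xy) (supp_in (suppV nx) xy)).
Qed.

(** A form of [act f z <> z] that tolerates errors on both sides, from moving inside [O] and from
    elements fixing [a]. It follows from disjoint neighbourhoods and joint continuity at
    [(1, z)]. *)
Lemma moved_nbhs z f : act f z <> z ->
  exists (a : seq L) (O : set X), nbhs z O /\
    forall (v v' : aut) y y', (forall x, x \in a -> v x = x) ->
      (forall x, x \in a -> v' x = x) -> O y -> O y' ->
      act f (act v y) <> act v' y'.
Proof.
move=> /eqP nfz; move: hX; rewrite open_hausdorff => /(_ _ _ nfz).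
move=> [[A B] /= [fzA zB] [oA oB /eqP AB]]; rewrite !inE in fzA zB.
have Wz : nbhs z ([set y | A (act f y)] `&` B).
  apply: filterI; first by apply: act_nbhs_pt; exact: open_nbhs_nbhs.
  exact: open_nbhs_nbhs.
rewrite -{1}[z]act1 in Wz; have [V [O [V1 Oz VO]]] := act_nbhs Wz.
have [a aV] := nbhs_aut1 V1.
exists a, O; split=> // v v' y y' /aV Vv /aV Vv' Oy Oy' e.
have [Afv _] := VO _ _ Vv Oy; have [_ Bv'] := VO _ _ Vv' Oy'.
suff: (A `&` B) (act v' y') by rewrite AB.
by split=> //; rewrite -e.
Qed.

Lemma dense_fixpoint : fixpoint_property C.
Proof.
move=> Y clY Y0 Yinv; apply: contrapT => nofix.
pose Y' := [set y | Y y /\ classes_fix y].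
have [y0 Yy0 y0fix] := classes_fixed cE fpE clY Y0 Yinv.
have Y'y0 : Y' y0 by [].
have clY' : closed Y'.
  move=> y cly; split; first by apply: clY => A /cly[w [[Yw _] Aw]]; exists w.
  move=> x Cx; apply: closed_fixed_by => A /cly[w [[_ wfix] Aw]].
  by exists w; split=> //; exact: wfix.
have Y'inv g y : supp C g -> Y' y -> Y' (act g y).
  by move=> gC [Yy yfix]; split; [exact: Yinv|exact: classes_fix_inv].
pose good (z : X) (p : aut * seq L * set X) := [/\ supp C p.1.1, nbhs z p.2 &
  forall (v v' : aut) y y', (forall x, x \in p.1.2 -> v x = x) ->
    (forall x, x \in p.1.2 -> v' x = x) -> p.2 y -> p.2 y' ->
    act p.1.1 (act v y) <> act v' y'].
have /choice[D DP] z : exists p, Y' z -> good z p.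
  case: (pselect (Y' z)) => [Y'z|nY'z]; last by exists (1%g, [::], set0).
  have [f [fC fz]] : exists f, supp C f /\ act f z <> z.
    apply: contrapT => H; apply: nofix; exists z; first by case: Y'z.
    by move=> f fC; apply: contrapT => fz; apply: H; exists f.
  have [a [O [Oz OP]]] := moved_nbhs fz.
  by exists (f, a, O).
pose f_ z := (D z).1.1; pose a_ z := (D z).1.2; pose O_ z := (D z).2.
(* Finitely many displacements [f_ z] suffice for all of [Y']; this gives both the finite set of
   colours and the finite set [F] for the Ramsey step. *)
have [zs zsY cover] : exists2 zs : seq X, forall z, z \in zs -> Y' z &
    forall y, Y' y -> exists2 z, z \in zs & O_ z y.
  apply: contrapT => ncov.
  have [||s|y Y'y yQ] := @compact_fip X Y' X
      (fun z => [set y | Y' z -> ~ (O_ z)^° y]).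
  - exact: (subclosed_compact clY' cX).
  - move=> z; case: (pselect (Y' z)) => [Y'z|nY'z].
      rewrite (_ : [set y | _] = ~` (O_ z)^°).
        by apply: open_closedC; exact: open_interior.
      by apply/seteqP; split=> y /= h; [exact: h|move=> _].
    rewrite (_ : [set y | _] = setT); first exact: closedT.
    by apply/seteqP; split=> y // _ /nY'z.
  - apply: contrapT => ns; apply: ncov.
    exists [seq z <- s | `[< Y' z >]].
      by move=> z; rewrite mem_filter => /andP[/asboolP].
    move=> y Y'y; apply: contrapT => ny; apply: ns; exists y => // z zs Y'z.
    move=> /interior_subset Oy; apply: ny; exists z => //.
    by rewrite mem_filter zs andbT; apply/asboolP.
  by have [_ Oy _] := DP y Y'y; exact: (yQ y Y'y).
pose a := flatten [seq a_ z | z <- zs].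
have [x0 [_ [Cx0 _ _]]] := pE; have [cl [clP cl_eq]] := class_repr cE x0.
pose u := sort <=%O (undup [seq cl x | x <- a & `[< C x >]]).
have uP x : x \in u -> C x /\ cl x = x.
  rewrite mem_sort mem_undup => /mapP[w]; rewrite mem_filter => /andP[/asboolP Cw _].
  have wcl := clP w Cw; move=> ->; split; first exact: (cc_in cE wcl).2.
  by rewrite -(cl_eq _ _ wcl).
have u_lt : pairwise (fun x y => `[< ltE C E x y >]) u.
  apply/(pairwiseP x0) => i j iu ju ij; apply/asboolP.
  have [Ci cli] := uP _ (mem_nth x0 iu); have [Cj clj] := uP _ (mem_nth x0 ju).
  have lt_ij : (nth x0 u i < nth x0 u j)%O.
    have : sorted <%O u by rewrite sort_lt_sorted undup_uniq.
    by rewrite lt_sorted_pairwise => /(pairwiseP x0); apply.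
  split=> // /cl_eq; rewrite cli clj => e.
  by rewrite e ltxx in lt_ij.
have a_u x : x \in a -> C x -> exists2 y, y \in u & E y x.
  move=> xa Cx; exists (cl x); last exact: (cc_sym cE (clP x Cx)).
  rewrite mem_sort mem_undup map_f // mem_filter xa andbT.
  exact/asboolP.
pose same_classes (g : aut) :=
  [set g' : aut | supp C g' /\ forall x, x \in u -> E (g x) (g' x)].
(* The piece of the cover containing g^-1 [y0] is not a function of the classes. Replacing [g] by a
   choice depending only on its class values on [u] makes the colour one. *)
pose rep (g : aut) : aut := xget 1%g (same_classes g).
have repP g : supp C g ->
    supp C (rep g) /\ forall x, x \in u -> E (g x) (rep g x).
  move=> gC; apply: (@xgetI _ _ (same_classes g) g); split=> // x xu.
  by apply: (cc_refl cE); apply: supp_in gC (uP _ xu).1.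
have y0g g : supp C g -> Y' (act g^-1%g y0).
  by move=> gC; apply: Y'inv Y'y0; exact: suppV.
have /choice[iota iotaP] g : exists i : 'I_(size zs), supp C g ->
    O_ (nth y0 zs i) (act g^-1%g y0).
  have idx z : z \in zs -> index z zs < size zs by rewrite index_mem.
  case: (pselect (supp C g)) => [gC|ngC].
    have [z zzs Oz] := cover _ (y0g g gC).
    by exists (Ordinal (idx z zzs)) => _; rewrite /= nth_index.
  by have [z zzs _] := cover _ Y'y0; exists (Ordinal (idx z zzs)).
have chiE g g' : supp C g -> supp C g' ->
    (forall x, x \in u -> E (g x) (g' x)) -> iota (rep g) = iota (rep g').
  move=> gC g'C gg'; congr iota; congr xget; apply/seteqP.
  split=> h [hC gh]; split=> // x xu.
    exact: (cc_trans cE (cc_sym cE (gg' x xu)) (gh x xu)).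
  exact: (cc_trans cE (gg' x xu) (gh x xu)).
(* The price of [rep] is an element [v] fixing [a], an error which [moved_nbhs] tolerates. *)
have near_rep g : supp C g -> exists v : aut, (forall x, x \in a -> v x = x) /\
    act g^-1%g y0 = act v (act (rep g)^-1%g y0).
  move=> gC; have [rC rE] := repP g gC.
  have [|||v [vC vz vu _]] := @absorb_classes (act (rep g)^-1%g y0)
      (g^-1 * rep g)%g u.
  - exact: (y0g _ rC).2.
  - exact: suppM (suppV gC) rC.
  - move=> x xu; have := cc_inv cE (suppV gC) (rE x xu).
    by rewrite autK autME.
  exists v; split; last by rewrite vz actM actVK.
  move=> x xa; case: (pselect (C x)) => [Cx|/vC//].
  by have [y yu yx] := a_u x xa Cx; exact: vu yu yx.
(* Inverses appear because multiplying [g] on the right by the inverse of [f_ z] moves g^-1 [y0] by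
   [f_ z]. *)
have [|g gC gF] := structural_ramsey L_countable cvC cE orbit_up orbit_down
    orbit_mid (F := [seq ((f_ z)^-1)%g | z <- zs]) Cx0 (fun x xu => (uP x xu).1)
    u_lt chiE.
  move=> _ /mapP[z zzs ->]; apply: suppV.
  by have [] := DP z (zsY z zzs).
pose z := nth y0 zs (iota (rep g)).
have zzs : z \in zs by apply: mem_nth; exact: ltn_ord.
have [fC _ sepz] := DP z (zsY z zzs).
have gfC : supp C (g * (f_ z)^-1)%g by exact: suppM gC (suppV fC).
have gf : iota (rep (g * (f_ z)^-1)%g) = iota (rep g).
  by apply: gF; apply/mapP; exists z.
have [v [va vg]] := near_rep _ gC; have [v' [v'a v'g]] := near_rep _ gfC.
have a_z x : x \in a_ z -> x \in a.
  by move=> xa; apply/flattenP; exists (a_ z) => //; exact: map_f.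
apply: (sepz v v' _ _ (fun x xa => va x (a_z x xa)) (fun x xa => v'a x (a_z x xa))).
- exact: iotaP (repP g gC).1.
- by rewrite /z -gf; exact: iotaP (repP _ gfC).1.
by rewrite -vg -v'g invgM invgK actM.
Qed.

End DenseClasses.

(** The induction runs on the size of a set [A] bounding the colours that occur in [C], which
    shrinks on the classes of any proper congruence, be it that of a cut or a maximal one. *)
Lemma convex_fixpoint (T : finType) (c : L -> L -> T) (A : {set T}) (C : set L) :
  countable [set: L] -> convex C -> pair_homogeneous c C ->
  (forall x y, C x -> C y -> c x y \in A) -> fixpoint_property C.
Proof.
move=> L_countable; have [n] := ubnP #|A|; elim: n => // n IHn in A C *.
rewrite ltnS => An cvC cC cA.
have fpE E : convex_congruence C E -> proper_rel C E ->
    forall x, C x -> fixpoint_property (E x).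
  move=> cE pE x Cx; have [A' A'A cA'] := class_colors cC x cE pE cA.
  apply: (IHn A'); first exact: leq_trans A'A An.
  - exact: (class_convex cE).
  - exact: (class_pair_homogeneous cC).
  - exact: cA'.
case: (pselect (forall x y, C x -> C y -> x = y)) => [C1|nC1].
  move=> Y _ [y Yy] _; exists y => // g gC; rewrite -[RHS]act1; congr act.
  apply: order_autP => x; case: (pselect (C x)) => [Cx|/gC//].
  by apply: C1 => //; exact: supp_in.
case: (pselect (exists2 I, invariant_cut C I & ~ C `<=` I)) => [[I cutI nCI]|ncut].
  apply: (cut_fixpoint cvC cutI nCI); apply: fpE; first exact: cut_congruence.
  have [IC _ _ [x Ix]] := cutI.
  have [y [Cy nIy]] : exists y, C y /\ ~ I y.
    apply: contrapT => H; apply: nCI => z Cz; apply: contrapT => nIz.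
    by apply: H; exists z.
  exists x, y; split=> //; first exact: IC.
  by move=> [_ _ [h _]]; exact/nIy/h.
have nc : no_cut C.
  by move=> I cutI; apply: contrapT => nCI; apply: ncut; exists I.
have [|E [cE pE maxE]] := maximal_congruence cC.
  (* Equality on [C] is proper once [C] has two points, and starts the search for a maximal
     congruence. *)
  exists (fun x y => C x /\ x = y).
    split=> //.
    - by move=> x y [Cx <-].
    - by move=> x y [Cx <-].
    - by move=> y x z [Cx <-] [_ <-].
    - by move=> x y z [Cx <-] xy yx; split=> //; apply/le_anti; rewrite xy yx.
    - by move=> g x y gC [Cx <-]; split=> //; exact: supp_in.
  apply: contrapT => np; apply: nC1 => x y Cx Cy; apply: contrapT => nxy.
  by apply: np; exists x, y; split=> // -[].
apply: (dense_fixpoint L_countable cvC cE pE) => //.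
- exact: (orbit_cofinal cE pE nc).
- exact: (orbit_coinitial cE pE nc).
- exact: (orbit_dense cC cE pE nc maxE cvC).
- exact: fpE.
Qed.

End Flow.

Theorem theorem1 (d : Order.disp_t) (L : orderType d)
  (hL : countably_categorical L) : extremely_amenable (order_aut L).
Proof.
move=> X X0 cX hX act act_cont; have [T [c cP]] := categorical_pair_orbits hL.
have fp : fixpoint_property act [set: L]%classic.
  apply: (convex_fixpoint cX hX act_cont (c := c) (A := [set: T]) hL.1) => //.
  move=> x y x' y' _ _ _ _ /cP[g [gx gy]]; exists g; split=> // z nz.
  by case: nz.
have [y _ yfix] := fp _ closedT X0 (fun _ _ _ _ => I).
by exists y => g; apply: yfix => x nx; case: nx.
Qed.
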